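(* Let $k\ge0$, $T>0$. Assume that the system $$\rho_s+u\omega=0,\qquad \omega_s=\rho u,\qquad \omega=u_y,\qquad y\in I=(y_L,y_R),\ s\in[0,T],$$ with Dirichlet boundary condition has a smooth solution $u,\rho,\omega$. Let $u_h$ (with values in $V_h^{k+1}$) and $\rho_h,\omega_h$ (with values in $V_h^k$) be the numerical solution of the semi-discrete integration DG scheme: for all $\phi,\varphi\in V_h^k$ and all cells $I_j$, $1\le j\le N$, $$((\rho_h)_s,\phi)_{I_j}+(u_h\omega_h,\phi)_{I_j}=0,$$ $$((\omega_h)_s,\varphi)_{I_j}=(\rho_hu_h,\varphi)_{I_j},$$ $$u_h(y,s)|_{I_j}=u_h(y_{j+1/2},s)-\int_y^{y_{j+1/2}}\omega_h(\xi,s)\,d\xi,$$ with boundary condition $u_h(y_{N+1/2},s)=u(y_R,s)$, where $u_h$ is continuous on $I$. Suppose that the initial data $u_h^0,\omega_h^0,\rho_h^0$ satisfy the approximation property $$\|u^0-u_h^0\|_{L^\infty(I)}+\|\rho^0-\rho_h^0\|_{L^2(I)}+\|\omega^0-\omega_h^0\|_{L^2(I)}\le Ch^{k+1}.$$ Then for a regular tessellation of $I$ there holds, for $s\in[0,T]$, $$\|u-u_h\|_{L^\infty(I)}+\|\omega-\omega_h\|_{L^2(I)}+\|\rho-\rho_h\|_{L^2(I)}\le Ch^{k+1},$$ where the positive constant $C$ depends on the final time $T$ and the exact solutions (and not on $h$).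
   Context: The interval $I$ is partitioned into cells $I_j=[y_{j-1/2},y_{j+1/2}]$, $j=1,\dots,N$, with $y_{1/2}=y_L$, $y_{N+1/2}=y_R$, $\Delta y_j=y_{j+1/2}-y_{j-1/2}$, $h=\max_j\Delta y_j$. ''Regular tessellation'' means that the meshes belong to a family for which $h/\min_j\Delta y_j$ is bounded uniformly. For $m\ge0$, $V_h^m$ is the space of functions $v$ on $I$ with $v|_{I_j}\in P^m(I_j)$ for all $j$ (polynomials of degree at most $m$ on each cell, possibly discontinuous across interfaces). $(u,v)_{I_j}=\int_{I_j}uv\,dy$. The superscript $0$ denotes the value at initial time $s=0$; subscripts $s,y$ denote derivatives. *)

(* Defs.v *)
From HB Require Import structures.
From mathcomp Require Import all_boot all_order all_algebra.
From mathcomp Require Import all_classical all_reals all_analysis.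

Set Implicit Arguments.
Unset Strict Implicit.
Unset Printing Implicit Defensive.

Import Order.TTheory GRing.Theory Num.Theory.
Import numFieldNormedType.Exports.

Local Open Scope classical_set_scope.
Local Open Scope ring_scope.

(* Functions of space and time are written with time first: [f s y] stands for
   f(y, s), so that [f s] is a function of the space variable. *)

(* Derivative relative to the closed interval [a, b]: the two-sided derivative
   inside, the one-sided one at [a] and at [b]. *)
Definition derivable_on (R : realType) (a b : R) (f : R -> R) (t : R) : Prop :=
  cvg ((f t' - f t) / (t' - t) @[t' --> within `[a, b] (dnbhs t)]).

Definition derive_on (R : realType) (a b : R) (f : R -> R) (t : R) : R :=
  lim ((f t' - f t) / (t' - t) @[t' --> within `[a, b] (dnbhs t)]).

(* C^oo up to the boundary of the rectangle: [d i j] is the mixed partial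
   derivative of order [i] in space and [j] in time. *)
Definition smooth_on (R : realType) (T yL yR : R) (f : R -> R -> R) : Prop :=
  exists d : nat -> nat -> R -> R -> R,
    {in `[0, T] & `[yL, yR], forall s y, d 0%N 0%N s y = f s y} /\
    forall i j : nat,
      {within [set z : R * R | z.1 \in `[0, T] /\ z.2 \in `[yL, yR]],
         continuous (fun z : R * R => d i j z.1 z.2)} /\
      {in `[0, T] & `[yL, yR], forall s y,
        [/\ derivable_on yL yR (d i j s) y,
            derive_on yL yR (d i j s) y = d i.+1 j s y,
            derivable_on 0 T (fun s' => d i j s' y) s &
            derive_on 0 T (fun s' => d i j s' y) s = d i j.+1 s y]}.

Record smooth_solution (R : realType) (T yL yR : R) (gL gR : R -> R)
    (u rho omega : R -> R -> R) : Prop := SmoothSolution {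
  smooth_u : smooth_on T yL yR u ;
  smooth_rho : smooth_on T yL yR rho ;
  smooth_omega : smooth_on T yL yR omega ;
  eq_rho : {in `[0, T] & `]yL, yR[, forall s y,
    derive_on 0 T (fun s' => rho s' y) s + u s y * omega s y = 0} ;
  eq_omega : {in `[0, T] & `]yL, yR[, forall s y,
    derive_on 0 T (fun s' => omega s' y) s = rho s y * u s y} ;
  eq_u : {in `[0, T] & `]yL, yR[, forall s y,
    omega s y = derive_on yL yR (u s) y} ;
  dirichlet : {in `[0, T], forall s, u s yL = gL s /\ u s yR = gR s}
}.

(* [x i] is the interface y_(i+1/2), so that, counting from 0, the cell of
   index [j] is [x j, x j.+1]; values of [x] beyond index [N] are irrelevant. *)
Definition is_mesh (R : realType) (yL yR : R) (N : nat) (x : nat -> R) : Prop :=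
  [/\ (0 < N)%N, x 0%N = yL, x N = yR &
      forall j, (j < N)%N -> x j < x j.+1].

Definition mesh_size (R : realType) (N : nat) (x : nat -> R) : R :=
  \big[Num.max/0]_(j < N) (x j.+1 - x j).

(* The seed [x N - x 0] of the minimum is harmless: on a mesh it bounds the
   length of every cell. *)
Definition mesh_min (R : realType) (N : nat) (x : nat -> R) : R :=
  \big[Num.min/(x N - x 0%N)]_(j < N) (x j.+1 - x j).

(* A family of meshes is regular if some [sigma] serves all its members. *)
Definition regular_mesh (R : realType) (sigma : R) (N : nat) (x : nat -> R)
    : Prop :=
  mesh_size N x / mesh_min N x <= sigma.

(* The space V_h^m. A member may jump at an interface, where its value is left
   free: only the polynomials on the open cells matter. *)
Definition dg_space (R : realType) (N : nat) (x : nat -> R) (m : nat)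
    (v : R -> R) : Prop :=
  forall j, (j < N)%N ->
    exists2 p : {poly R}, (size p <= m.+1)%N &
      {in `]x j, x j.+1[, forall y, v y = p.[y]}.

Definition cell_dot (R : realType) (x : nat -> R) (j : nat) (v w : R -> R)
    : R :=
  \int[lebesgue_measure]_(y in `[x j, x j.+1]) (v y * w y).

Record idg_solution (R : realType) (k : nat) (T yL yR : R)
    (u : R -> R -> R) (N : nat) (x : nat -> R)
    (uh rhoh omegah : R -> R -> R) : Prop := IdgSolution {
  uh_space : {in `[0, T], forall s, dg_space N x k.+1 (uh s)} ;
  rhoh_space : {in `[0, T], forall s, dg_space N x k (rhoh s)} ;
  omegah_space : {in `[0, T], forall s, dg_space N x k (omegah s)} ;
  derivable_rhoh : forall j, (j < N)%N ->
    {in `[0, T] & `]x j, x j.+1[, forall s y,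
      derivable_on 0 T (fun s' => rhoh s' y) s} ;
  derivable_omegah : forall j, (j < N)%N ->
    {in `[0, T] & `]x j, x j.+1[, forall s y,
      derivable_on 0 T (fun s' => omegah s' y) s} ;
  scheme_rho : forall s (phi : R -> R) j,
    s \in `[0, T] -> dg_space N x k phi -> (j < N)%N ->
    cell_dot x j (fun y => derive_on 0 T (fun s' => rhoh s' y) s) phi
      + cell_dot x j (fun y => uh s y * omegah s y) phi = 0 ;
  scheme_omega : forall s (phi : R -> R) j,
    s \in `[0, T] -> dg_space N x k phi -> (j < N)%N ->
    cell_dot x j (fun y => derive_on 0 T (fun s' => omegah s' y) s) phi
      = cell_dot x j (fun y => rhoh s y * uh s y) phi ;
  scheme_u : forall j, (j < N)%N ->
    {in `[0, T] & `[x j, x j.+1], forall s y,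
      uh s y = uh s (x j.+1)
               - \int[lebesgue_measure]_(xi in `[y, x j.+1]) omegah s xi} ;
  uh_boundary : {in `[0, T], forall s, uh s (x N) = u s yR} ;
  uh_continuous : {in `[0, T], forall s,
    {within `[yL, yR], continuous (uh s)}}
}.

Definition Lp_norm_on (R : realType) (p : \bar R) (a b : R) (f : R -> R)
    : \bar R :=
  Lnorm lebesgue_measure p (EFin \o (f \_ `]a, b[)).

Definition norm_Loo (R : realType) (a b : R) (f : R -> R) : \bar R :=
  Lp_norm_on +oo%E a b f.

Definition norm_L2 (R : realType) (a b : R) (f : R -> R) : \bar R :=
  Lp_norm_on 2%:E a b f.

(* Main.v *)
(** Testing the scheme against the numerical solution itself shows that
    ∫(ρ_h² + ω_h²) is conserved on each cell, which bounds u_h uniformly without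
    any smallness assumption on h. Let ε_ρ, ε_ω be the differences between the
    piecewise Taylor polynomials of ρ, ω and ρ_h, ω_h. In the evolution of
    E = ∫(ε_ρ² + ε_ω²) the cubic terms u_h ε_ρ ε_ω cancel; what is left is
    bounded by ε, the Taylor remainders O(h^(k+1)), and u - u_h, where
    (u - u_h)² <= |I| ∫(ω - ω_h)² since both functions agree at y_R. Gronwall's
    inequality then gives E = O(h^(2k+2)). *)

Require Import Defs.
From HB Require Import structures.
From mathcomp Require Import all_boot all_order all_algebra.
From mathcomp Require Import all_classical all_reals all_analysis.
From mathcomp Require Import measurable_realfun ess_sup_inf ring lra.

Import Order.TTheory GRing.Theory Num.Theory.
Import numFieldNormedType.Exports.

Local Open Scope classical_set_scope.
Local Open Scope ring_scope.

(** * Functions continuous on a cell, and their integrals *)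

(** The evolution equations of the scheme have no flux terms: on a cell, [uh] is a mere coefficient,
    and cells communicate only through the integral that defines it. Energies can therefore be
    differentiated cell by cell, but Gronwall's argument closes only after summation over the cells,
    since [u - uh] at a point involves the omega errors of all cells to its right. Two obstacles
    shape the preparation. Values at interfaces are free and time derivatives are assumed only
    inside the cells, so identities and inequalities are proved on open cells and carried to
    integrals over closed ones. Moreover differentiability in time is given pointwise in [y],
    without the uniformity that would justify differentiating under the integral sign. Instead, a
    polynomial of degree at most k is determined by its values at k+1 interior nodes, so each energy
    is a quadratic form in nodal values with a matrix independent of time, and the product rule is
    enough. As the final constant is chosen before the mesh, the bound on [uh] is freed of h through
    h <= yR - yL. *)

Section cell_integral.
Set Implicit Arguments.
Unset Strict Implicit.
Variable R : realType.
Implicit Types (a b c : R) (f g : R -> R).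
Notation mu := (@lebesgue_measure R).

Lemma within_continuous_horner (A : set R) (p : {poly R}) :
  {within A, continuous (horner p)}.
Proof.
elim/poly_ind: p => [|p c IHp].
  under [X in {within A, continuous X}]funext do rewrite horner0.
  by move=> t; exact: cvg_cst.
under [X in {within A, continuous X}]funext do rewrite hornerMXaddC.
move=> t; apply: (@cvgD _ R^o); last exact: cvg_cst.
apply: cvgM; first exact: IHp.
by apply: (@continuous_subspaceT _ _ A (@idfun R)) => y; exact: cvg_id.
Qed.

(** Members of [dg_space] are prescribed on open cells only and may take any value at an interface,
    so they need not be continuous up to the ends. A continuous representative [g] on the closed
    cell is enough for integrability, the endpoints being a null set. *)
Definition continuous_cell a b f :=
  exists2 g, {within `[a, b], continuous g} & {in `]a, b[, f =1 g}.

Lemma continuous_cellW a b f : {within `[a, b], continuous f} ->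
  continuous_cell a b f.
Proof. by exists f. Qed.

Lemma continuous_cell_horner a b (p : {poly R}) f :
  {in `]a, b[, forall y, f y = p.[y]} -> continuous_cell a b f.
Proof. by exists (horner p) => //; exact: within_continuous_horner. Qed.

Lemma continuous_cell_cst a b c : continuous_cell a b (fun=> c).
Proof. by apply: continuous_cellW => t; exact: cvg_cst. Qed.

Lemma continuous_cellD a b f g : continuous_cell a b f ->
  continuous_cell a b g -> continuous_cell a b (fun y => f y + g y).
Proof.
move=> [f' cf ff'] [g' cg gg']; exists (fun y => f' y + g' y).
  by move=> t; apply: (@cvgD _ R^o); [exact: cf|exact: cg].
by move=> y yab; rewrite ff' ?gg'.
Qed.

Lemma continuous_cellM a b f g : continuous_cell a b f ->
  continuous_cell a b g -> continuous_cell a b (fun y => f y * g y).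
Proof.
move=> [f' cf ff'] [g' cg gg']; exists (fun y => f' y * g' y).
  by move=> t; apply: cvgM; [exact: cf|exact: cg].
by move=> y yab; rewrite ff' ?gg'.
Qed.

Lemma continuous_cellN a b f : continuous_cell a b f ->
  continuous_cell a b (fun y => - f y).
Proof.
move=> [f' cf ff']; exists (fun y => - f' y).
  by move=> t; apply: (@cvgN _ R^o); exact: cf.
by move=> y yab; rewrite ff'.
Qed.

Lemma continuous_cellB a b f g : continuous_cell a b f ->
  continuous_cell a b g -> continuous_cell a b (fun y => f y - g y).
Proof. by move=> cf cg; exact/continuous_cellD/continuous_cellN. Qed.

Lemma continuous_cellX2 a b f : continuous_cell a b f ->
  continuous_cell a b (fun y => f y ^+ 2).
Proof.
move=> cf; under [X in continuous_cell _ _ X]funext do rewrite expr2.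
exact: continuous_cellM.
Qed.

Lemma integrable_itv_oo_cc a b (f : R -> \bar R) :
  mu.-integrable `]a, b[ f -> mu.-integrable `[a, b] f.
Proof.
move=> /integrableP[mf foo].
have mf' : measurable_fun `[a, b] f.
  exact/emeasurable_fun_itv_bndo_bndcP/emeasurable_fun_itv_obnd_cbndP.
apply/integrableP; split => //; rewrite integral_itv_bndoo//.
exact: measurableT_comp.
Qed.

Lemma continuous_cell_integrable a b f : continuous_cell a b f ->
  mu.-integrable `[a, b] (EFin \o f).
Proof.
move=> [g cg fg]; apply: integrable_itv_oo_cc.
apply: (@eq_integrable _ _ _ mu _ _ (EFin \o g)) => //=.
  by move=> y; rewrite inE/= => yab; rewrite fg.
apply: (@integrableS _ _ _ mu `[a, b]) => //; first exact: subset_itv_oo_cc.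
by apply: continuous_compact_integrable => //; exact: segment_compact.
Qed.

Lemma eq_Rintegral_oo a b f g : continuous_cell a b f ->
  {in `]a, b[, f =1 g} ->
  \int[mu]_(y in `[a, b]) f y = \int[mu]_(y in `[a, b]) g y.
Proof.
move=> cf fg; rewrite /Rintegral; congr fine.
have mf : measurable_fun `]a, b[ f.
  apply/measurable_EFinP; apply: (measurable_int mu).
  apply: (@integrableS _ _ _ mu `[a, b]) => //; first exact: subset_itv_oo_cc.
  exact: continuous_cell_integrable.
apply: eq_integral_itv_bounded => //.
by apply: (eq_measurable_fun f) => // y; rewrite inE/= => yab; rewrite fg.
Qed.

Lemma le_Rintegral_oo a b f g : continuous_cell a b f -> continuous_cell a b g ->
  (forall y, y \in `]a, b[ -> f y <= g y) ->
  \int[mu]_(y in `[a, b]) f y <= \int[mu]_(y in `[a, b]) g y.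
Proof.
(* Monotonicity of the integral is applied on the closed interval, whereas [fg] is silent at the
   endpoints. The maximum [g'] dominates [f] everywhere and agrees with [g] inside. *)
move=> cf cg fg; pose g' y := Num.max (f y) (g y).
have gg' : {in `]a, b[, g =1 g'}.
  by move=> y /fg fgy; rewrite /g' max_r.
have cg' : continuous_cell a b g'.
  by case: cg => h ch gh; exists h => // y yab; rewrite -gg' ?gh.
rewrite (eq_Rintegral_oo cg gg'); apply: le_Rintegral => //.
- exact: continuous_cell_integrable.
- exact: continuous_cell_integrable.
- by move=> y _; rewrite /g' le_max lexx.
Qed.

Lemma Rintegral_cst_itv a b c : a <= b ->
  \int[mu]_(y in `[a, b]) c = c * (b - a).
Proof.
move=> ab; have muab : mu `[a, b]%classic = (b - a)%:E.
  rewrite lebesgue_measure_itv/= lte_fin EFinB.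
  by case: ltgtP ab => // -> _; rewrite subee.
by rewrite Rintegral_cst//= muab.
Qed.

(* Jensen: expand the nonnegative integral of the squared deviation from the
   mean. *)
Lemma sqr_Rintegral_le a b f : a < b ->
  mu.-integrable `[a, b] (EFin \o f) ->
  mu.-integrable `[a, b] (EFin \o (fun y => f y ^+ 2)) ->
  (\int[mu]_(y in `[a, b]) f y) ^+ 2
    <= (b - a) * \int[mu]_(y in `[a, b]) (f y ^+ 2).
Proof.
move=> ab if1 if2.
set F := \int[mu]_(y in `[a, b]) f y; set G := \int[mu]_(y in `[a, b]) (f y ^+ 2).
have ba0 : 0 < b - a by rewrite subr_gt0.
pose m := F / (b - a).
have : 0 <= \int[mu]_(y in `[a, b]) (f y ^+ 2 - (2 * m) * f y + m ^+ 2).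
  apply: Rintegral_ge0 => y _.
  by rewrite [leRHS](_ : _ = (f y - m) ^+ 2) ?sqr_ge0//; ring.
have if3 : mu.-integrable `[a, b] (EFin \o (fun y => (2 * m) * f y)).
  exact: (@integrableZl _ _ _ mu `[a, b] _ (2 * m) (EFin \o f)).
have if4 : mu.-integrable `[a, b] (EFin \o (fun=> m ^+ 2)).
  exact/continuous_cell_integrable/continuous_cell_cst.
rewrite RintegralD//; last first.
  exact: (@integrableB _ _ _ mu `[a, b] _ (EFin \o (fun y => f y ^+ 2))
    (EFin \o (fun y => (2 * m) * f y))).
rewrite RintegralB// RintegralZl// (Rintegral_cst_itv _ (ltW ab)) -/F -/G => h.
have Fm : F = m * (b - a) by rewrite /m divfK// gt_eqF.
clearbody m F G; rewrite {}Fm in h *.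
have -> : (m * (b - a)) ^+ 2 = (b - a) * (m ^+ 2 * (b - a)) by ring.
rewrite ler_pM2l//; move: h.
have -> : G - 2 * m * (m * (b - a)) + m ^+ 2 * (b - a) = G - m ^+ 2 * (b - a) by ring.
by rewrite subr_ge0.
Qed.

End cell_integral.

(** * Integrals over a mesh *)

Section mesh_integral.
Set Implicit Arguments.
Unset Strict Implicit.
Variable R : realType.
Notation mu := (@lebesgue_measure R).
Variables (N : nat) (x : nat -> R).
Hypothesis x_incr : forall j, (j < N)%N -> x j < x j.+1.

Lemma mesh_le i j : (i <= j <= N)%N -> x i <= x j.
Proof.
elim: j => [|j IHj] /andP[]; first by rewrite leqn0 => /eqP->.
rewrite leq_eqVlt => /predU1P[->//|]; rewrite ltnS => ij jN.
by apply: le_trans (ltW (x_incr jN)); rewrite IHj// ij ltnW.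
Qed.

Lemma integrable_itv_cat (a b c : R) (f : R -> \bar R) : a <= b -> b <= c ->
  mu.-integrable `[a, b] f -> mu.-integrable `[b, c] f ->
  mu.-integrable `[a, c] f.
Proof.
move=> ab bc /integrableP[mf foo] /integrableP[mg goo].
have E : `[a, c]%classic = `[a, b] `|` `]b, c].
  by rewrite (@itv_bndbnd_setU _ _ _ (BRight b)) ?bnd_simp.
have mg' : measurable_fun `]b, c] f.
  by apply: measurable_funS mg => //; exact: subset_itv_oc_cc.
have mh : measurable_fun (`[a, b] `|` `]b, c]) f by exact/measurable_funU.
apply/integrableP; rewrite E; split => //.
rewrite ge0_integral_setU//; last 2 first.
- exact: measurableT_comp.
- apply/disj_setPS => y /=; rewrite !in_itv/= => -[/andP[_ yb] /andP[by_ _]].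
  by move: (lt_le_trans by_ yb); rewrite ltxx.
apply: lte_add_pinfty => //; apply: le_lt_trans goo.
apply: ge0_subset_integral => //; first exact: measurableT_comp.
exact: subset_itv_oc_cc.
Qed.

Lemma Rintegral_itv_cat (a b c : R) (f : R -> R) : a <= b -> b <= c ->
  mu.-integrable `[a, c] (EFin \o f) ->
  \int[mu]_(y in `[a, c]) f y
    = \int[mu]_(y in `[a, b]) f y + \int[mu]_(y in `[b, c]) f y.
Proof.
move=> ab bc fi; rewrite -(@Rintegral_itv_obnd_cbnd _ b (BRight c)); last first.
  apply: (@integrableS _ _ _ mu `[a, c]) => //.
  by apply: subset_itv; rewrite bnd_simp.
by rewrite -(Rintegral_itvB fi) ?bnd_simp// addrC subrK.
Qed.

(** Integrability and additivity share one induction: splitting the integral at [x n] presupposes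
    integrability across that interface, where [f] may jump. *)
Lemma mesh_integral n f : (n <= N)%N ->
  (forall j, (j < N)%N -> continuous_cell (x j) (x j.+1) f) ->
  mu.-integrable `[x 0%N, x n] (EFin \o f) /\
  \int[mu]_(y in `[x 0%N, x n]) f y
    = \sum_(j < n) \int[mu]_(y in `[x j, x j.+1]) f y.
Proof.
move=> + cf; elim: n => [|n IHn] nN.
  rewrite big_ord0 set_itv1 Rintegral_set1; split => //.
  rewrite -set_itv1; apply: continuous_cell_integrable.
  exists (fun=> 0) => [t|y]; first exact: cvg_cst.
  by rewrite in_itv/= => /andP[/lt_trans h /h]; rewrite ltxx.
have [if1 E] := IHn (ltnW nN).
have if2 := continuous_cell_integrable (cf _ nN).
have if3 : mu.-integrable `[x 0%N, x n.+1] (EFin \o f).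
  apply: integrable_itv_cat if1 if2; last exact: ltW (x_incr nN).
  by apply: mesh_le; rewrite (ltnW nN).
split => //; rewrite big_ord_recr/= -E.
apply: Rintegral_itv_cat => //; last exact: ltW (x_incr nN).
by apply: mesh_le; rewrite (ltnW nN).
Qed.

End mesh_integral.

(** * Derivatives relative to an interval *)

Section one_sided_derivative.
Set Implicit Arguments.
Unset Strict Implicit.
Variable R : realType.
Implicit Types (a b t : R) (f g : R -> R).

(** Passes from the difference quotients of [derive_on] to the increments [h] of [derive]: close
    enough to an interior point, the restriction to [[a, b]] excludes nothing. *)
Lemma cvg_shift_within a b t : a < t -> t < b ->
  (h + t) @[h --> (0 : R)^'] --> within `[a, b] t^'.
Proof.
move=> at_ tb U; rewrite /within/= => tU.
have /nbhs_ballP[e /= e0 eU] : nbhs t (fun y => y != t -> `[a, b]%classic y -> U y).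
  exact: tU.
pose d := Num.min e (Num.min (t - a) (b - t)).
have d0 : 0 < d by rewrite !lt_min e0 !subr_gt0 at_ tb.
apply/nbhs_ballP; exists d => // h; rewrite /ball/= sub0r normrN => hd h0.
move: hd; rewrite /d !lt_min => /and3P[he ha hb].
apply: eU.
- by rewrite /ball/= opprD addrCA subrr addr0 normrN.
- by rewrite -subr_eq0 addrK.
- rewrite /= in_itv/=; move: ha hb; rewrite !ltr_norml => /andP[h1 _] /andP[_ h2].
  by apply/andP; split; lra.
Qed.

Lemma derivable_on_is_derive a b f t : t \in `]a, b[ -> derivable_on a b f t ->
  is_derive t (1 : R) f (derive_on a b f t).
Proof.
rewrite in_itv/= => /andP[at_ tb] df.
have cf : h^-1 *: (f (h *: 1 + t) - f t) @[h --> 0^'] --> derive_on a b f t.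
  have := cvg_comp _ _ (cvg_shift_within at_ tb) df.
  apply: cvg_trans; apply: near_eq_cvg; near=> h => /=.
  by rewrite /= addrK /GRing.scale/= mulr1 mulrC.
apply: DeriveDef; first by apply/cvg_ex; eexists; exact: cf.
exact/cvg_lim.
Unshelve. all: by end_near. Qed.

Lemma derivable_on_continuous a b f :
  {in `[a, b], forall t, derivable_on a b f t} -> {within `[a, b], continuous f}.
Proof.
move=> df; apply/subspace_continuousP => t tab.
have /df/cvg_ex[l fl] : t \in `[a, b] by [].
(* Writing [f t'] as [t' - t] times the difference quotient plus [f t] yields the limit along the
   punctured filter only; the point [t] itself is added back by the final case analysis. *)
have h1 : ((t' - t) * ((f t' - f t) / (t' - t)) + f t)
    @[t' --> within `[a, b] t^'] --> (0 * l + f t).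
  apply: (@cvgD _ R^o); last exact: cvg_cst.
  apply: cvgM => //.
  have h0 : (t' - t) @[t' --> within `[a, b] t^'] --> t - t.
    apply: (@cvgB _ R^o); last exact: cvg_cst.
    exact: cvg_trans (cvg_within _) (cvg_within _).
  by rewrite subrr in h0.
rewrite mul0r add0r in h1.
move=> U Uft; have := h1 _ Uft.
rewrite /fmap/=.
move=> H; have : \forall y \near t, y != t -> `[a, b]%classic y ->
   U ((y - t) * ((f y - f t) / (y - t)) + f t) by exact: H.
apply: filterS => y /= + yab.
have [->|yt /(_ isT yab)] := eqVneq y t; first by move=> _; exact: nbhs_singleton.
by rewrite mulrC divfK ?subr_eq0// subrK.
Qed.

Lemma derive_on_eq a b f g t : t \in `[a, b] -> {in `[a, b], f =1 g} ->
  derive_on a b f t = derive_on a b g t.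
Proof.
move=> tab fg; rewrite /derive_on; congr (lim _).
by apply/seteqP; split; apply: (@fmap_within_eq _ `[a, b] _ t^') => t';
  rewrite inE/= => t'ab; rewrite !fg.
Qed.

End one_sided_derivative.

Section gronwall.
Variable R : realType.

(** The function [E + D], weighted by [expR (- A * s)], is nonincreasing: its derivative carries the
    factor [dE s - A * (E s + D)], and [1 <= A] gives [D <= A * D]. Shifting [E] by [D] itself
    avoids the quotient [D / A]. *)
Lemma gronwall (T A D : R) (E dE : R -> R) : 0 < T -> 0 <= D -> 1 <= A ->
  {within `[0, T], continuous E} ->
  (forall s : R, s \in `]0, T[ -> is_derive s (1 : R) E (dE s)) ->
  (forall s : R, s \in `]0, T[ -> dE s <= A * E s + D) ->
  0 <= E 0 ->
  forall s : R, s \in `[0, T] -> E s + D <= (E 0 + D) * expR (A * T).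
Proof.
move=> T0 D0 A1 cE dEE dEle E0 s sT.
pose G (r : R) := expR (- A * r).
have dG (r : R) : is_derive r (1 : R) G (- A * expR (- A * r)).
  have dA : is_derive r (1 : R) ( *%R (- A)) (- A).
    by apply: is_derive_eq; rewrite [_%:A]mulr1.
  have := @is_derive1_comp _ expR ( *%R (- A)) r _ _ (is_derive_expR _) dA.
  by rewrite mulrC.
pose F := (E + cst D) * G.
have dF r : r \in `]0, T[ -> is_derive r (1 : R) F
   ((E r + D) * (- A * expR (- A * r)) + expR (- A * r) * dE r).
  move=> rT; have dEr := dEE r rT; have dGr := dG r.
  by apply: is_derive_eq; rewrite addr0.
have cF : {within `[0, T], continuous F}.
  move=> r; apply: cvgM.
    by apply: (@cvgD _ R^o); [exact: cE|exact: cvg_cst].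
  apply: continuous_subspaceT => q.
  have dGq := dG q.
  by apply/differentiable_continuous/derivable1_diffP; exact: ex_derive.
have s0T := sT; rewrite in_itv/= in s0T; case/andP: s0T => s0 sleT.
have : F s <= F 0.
  apply: (@ler0_derive1_le_cc _ F 0 T) => //.
  - by move=> r rT; have := dF r rT => dFr; exact: ex_derive.
  - move=> r rT; have := dF r rT => dFr; rewrite derive1E derive_val.
    have -> : (E r + D) * (- A * expR (- A * r)) + expR (- A * r) * dE r
              = expR (- A * r) * (dE r - A * (E r + D)) by ring.
    rewrite mulr_ge0_le0 ?expR_ge0//.
    rewrite mulrDr subr_le0; apply: le_trans (dEle r rT) _.
    by rewrite lerD2l ler_peMl.
  - by rewrite in_itv/= lexx ltW.
rewrite /F /G !fctE /cst mulr0 expR0 mulr1 => h.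
have : E s + D <= (E 0 + D) * expR (A * s).
  by rewrite -ler_pdivrMr ?expR_gt0// -expRN -mulNr.
(* Since [E 0 + D] is nonnegative, [s] may be replaced by [T] in the exponent, which makes the bound
   uniform in time. *)
move=> /le_trans; apply; rewrite ler_wpM2l ?addr_ge0// ler_expR ler_wpM2l//.
exact: le_trans A1.
Qed.

End gronwall.

(** * Time derivative of the energy of a polynomial family *)

Section time_derivative_of_energy.
Set Implicit Arguments.
Unset Strict Implicit.
Variable R : realType.
Notation mu := (@lebesgue_measure R).

Lemma within_continuous_sum (A : set R) (n : nat) (h : 'I_n -> R -> R) :
  (forall i, {within A, continuous (h i)}) ->
  {within A, continuous (fun s => \sum_(i < n) h i s)}.
Proof.
move=> ch; elim: (index_enum _) => [|i e IHe].
  under [X in {within _, continuous X}]funext do rewrite big_nil.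
  by move=> t; exact: cvg_cst.
under [X in {within _, continuous X}]funext do rewrite big_cons.
by move=> t; apply: (@cvgD _ R^o); [exact: ch|exact: IHe].
Qed.

(** The condition of [dg_space] on a single cell, with [n] bounding the size: degree at most [k]
    reads [poly_on k.+1]. *)
Definition poly_on (n : nat) (a b : R) (v : R -> R) :=
  exists2 p : {poly R}, (size p <= n)%N & {in `]a, b[, forall y, v y = p.[y]}.

Lemma poly_on_cell n a b v : poly_on n a b v -> continuous_cell a b v.
Proof. by case=> p _ vp; exact: continuous_cell_horner vp. Qed.

Lemma poly_onB n a b v w : poly_on n a b v -> poly_on n a b w ->
  poly_on n a b (fun y => v y - w y).
Proof.
move=> [p sp vp] [q sq wq]; exists (p - q).
  by rewrite (leq_trans (size_polyD _ _))// size_polyN geq_max sp.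
by move=> y yab; rewrite hornerD hornerN vp ?wq.
Qed.

Variables (a b : R).
Hypothesis ab : a < b.

Let J (p : {poly R}) := \int[mu]_(y in `[a, b]) p.[y].

Let J_lin (c : R) (p q : {poly R}) : J (c *: p + q) = c * J p + J q.
Proof.
have ip (p' : {poly R}) : mu.-integrable `[a, b] (EFin \o horner p').
  by apply: continuous_cell_integrable; exact: (@continuous_cell_horner _ _ _ p').
have iZ : mu.-integrable `[a, b] (EFin \o (fun y => c * p.[y])).
  apply: continuous_cell_integrable.
  by apply: (@continuous_cell_horner _ _ _ (c *: p)) => y _; rewrite hornerZ.
rewrite /J -RintegralZl; [|by []|exact: ip].
rewrite -RintegralD; [|by []|exact: iZ|exact: ip].
by apply: eq_Rintegral => y _; rewrite hornerD hornerZ.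
Qed.

Let J0 : J 0 = 0.
Proof. by have := J_lin (-1) 0 0; rewrite scaler0 addr0 mulN1r addNr. Qed.

Let J_sum (n : nat) (c : 'I_n -> R) (p : 'I_n -> {poly R}) :
  J (\sum_(i < n) c i *: p i) = \sum_(i < n) c i * J (p i).
Proof.
have JD : {morph J : p q / p + q}.
  by move=> q q'; rewrite -[q]scale1r J_lin mul1r scale1r.
rewrite (big_morph J JD J0); apply: eq_bigr => i _.
by rewrite -[_ *: _]addr0 J_lin J0 addr0.
Qed.

(** Distinct interpolation points. Denominators start at 2 in order to stay off [b]: only values in
    the open interval are controlled. *)
Let node (i : nat) : R := a + (b - a) / i.+2%:R.

Let node_itv i : node i \in `]a, b[.
Proof.
have ba0 : 0 < b - a by rewrite subr_gt0.
rewrite in_itv/= /node ltrDl divr_gt0//= -ltrBrDl.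
by rewrite ltr_pdivrMr// ltr_pMr// ltr1n.
Qed.

Let node_inj : injective node.
Proof.
move=> i j /addrI /mulfI; rewrite subr_eq0 gt_eqF// => /(_ isT) /invr_inj.
by move=> /eqP; rewrite eqr_nat => /eqP[].
Qed.

Variable k : nat.

Let L (i : 'I_k.+1) : {poly R} := tnth (k.+1.-lagrange node) i.

Let size_L i : size (L i) = k.+1.
Proof. exact: size_lagrange_. Qed.

Let poly_nodes (p : {poly R}) : (size p <= k.+1)%N ->
  p = \sum_(i < k.+1) p.[node i] *: L i.
Proof.
move=> sp; rewrite {1}(lagrange_gen _ node_inj sp)//.
by apply: eq_bigr => i _; rewrite mul_polyC.
Qed.

(** The numbers [J (L i * L l)] form the Gram matrix of the Lagrange basis. It does not depend on
    time, which enters the energy through the nodal values alone. *)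
Let quad (c d : 'I_k.+1 -> R) :
  J ((\sum_(i < k.+1) c i *: L i) * (\sum_(l < k.+1) d l *: L l)) =
  \sum_(i < k.+1) \sum_(l < k.+1) c i * d l * J (L i * L l).
Proof.
rewrite mulr_suml.
under eq_bigr do rewrite -scalerAl.
rewrite J_sum; apply: eq_bigr => i _; rewrite mulr_sumr.
under eq_bigr do rewrite -scalerAr.
rewrite J_sum mulr_sumr; apply: eq_bigr => l _.
by rewrite mulrA.
Qed.

Variables (T : R) (r dr : R -> R -> R).
Hypothesis r_poly : {in `[0, T], forall s, poly_on k.+1 a b (r s)}.
Hypothesis r_cont : {in `]a, b[, forall y, {within `[0, T], continuous (r ^~ y)}}.
Hypothesis r_diff : {in `]0, T[ & `]a, b[, forall s y,
  is_derive s (1 : R) (r ^~ y) (dr s y)}.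

Let r_nodes (s y : R) : s \in `[0, T] -> y \in `]a, b[ ->
  r s y = (\sum_(i < k.+1) r s (node i) *: L i).[y].
Proof.
move=> sT yab; have [p sp rp] := r_poly sT.
rewrite rp// [in LHS](poly_nodes sp); congr (_.[y]).
by apply: eq_bigr => i _; rewrite rp.
Qed.

(** Interpolation holds at all times near [s] with the same basis, so it can be differentiated term
    by term; uniqueness of the derivative then makes [dr s] a polynomial on the cell as well. *)
Let dr_nodes (s y : R) : s \in `]0, T[ -> y \in `]a, b[ ->
  dr s y = (\sum_(i < k.+1) dr s (node i) *: L i).[y].
Proof.
move=> sT yab.
have rE : \forall s' \near s, r ^~ y s' =
    (\sum_(i < k.+1) (fun s' => r s' (node i)) * (cst (L i).[y])) s'.
  have := near_in_itvoo sT; apply: filterS => s' s'T.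
  rewrite r_nodes//; last by apply: subset_itv_oo_cc.
  by rewrite horner_sum fct_sumE; apply: eq_bigr => i _; rewrite hornerZ.
have d1 := r_diff sT yab.
have d2 (i : 'I_k.+1) : is_derive s (1 : R)
   ((fun s' => r s' (node i)) * (cst (L i).[y])) (dr s (node i) * (L i).[y]).
  have := r_diff sT (node_itv i) => h.
  by apply: is_derive_eq; rewrite scaler0 add0r mulrC.
have := near_eq_derive (1 : R) rE; rewrite derive_val => ->.
by rewrite derive_val horner_sum; apply: eq_bigr => i _; rewrite hornerZ.
Qed.

Lemma poly_on_time_derivative (s : R) : s \in `]0, T[ -> poly_on k.+1 a b (dr s).
Proof.
move=> sT; exists (\sum_(i < k.+1) dr s (node i) *: L i) => [|y yab].
  apply: leq_trans (size_sum _ _ _) _; apply/bigmax_leqP => i _.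
  by rewrite (leq_trans (size_scale_leq _ _))// size_L.
exact: dr_nodes.
Qed.

Let energy_nodes (s : R) : s \in `[0, T] ->
  \int[mu]_(y in `[a, b]) (r s y ^+ 2) = \sum_(i < k.+1) \sum_(l < k.+1)
    r s (node i) * r s (node l) * J (L i * L l).
Proof.
move=> sT; rewrite -quad; apply: eq_Rintegral_oo.
  exact/continuous_cellX2/poly_on_cell/r_poly.
by move=> y yab; rewrite r_nodes// hornerM expr2.
Qed.

Lemma energy_continuous :
  {within `[0, T], continuous (fun s => \int[mu]_(y in `[a, b]) (r s y ^+ 2))}.
Proof.
apply: (@subspace_eq_continuous _ _ _ (fun s => \sum_(i < k.+1) \sum_(l < k.+1)
    r s (node i) * r s (node l) * J (L i * L l))).
  by move=> s; rewrite inE => sT; apply/esym/energy_nodes.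
apply: (within_continuous_sum (h := fun i s =>
  \sum_(l < k.+1) r s (node i) * r s (node l) * J (L i * L l))) => i.
apply: (within_continuous_sum (h := fun l s =>
  r s (node i) * r s (node l) * J (L i * L l))) => l t.
by apply: cvgM; [apply: cvgM; exact: r_cont|exact: cvg_cst].
Qed.

Lemma energy_is_derive (s : R) : s \in `]0, T[ ->
  is_derive s (1 : R) (fun s => \int[mu]_(y in `[a, b]) (r s y ^+ 2))
    (2 * \int[mu]_(y in `[a, b]) (dr s y * r s y)).
Proof.
move=> sT.
have d1 (i l : 'I_k.+1) : is_derive s (1 : R)
   ((fun s => r s (node i)) * (fun s => r s (node l)) * cst (J (L i * L l)))
   ((dr s (node i) * r s (node l) + dr s (node l) * r s (node i)) * J (L i * L l)).
  have h1 := r_diff sT (node_itv i); have h2 := r_diff sT (node_itv l).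
  apply: is_derive_eq; rewrite scaler0 add0r /GRing.scale/=; ring.
have sT' : s \in `[0, T] by exact: subset_itv_oo_cc.
have dE : is_derive s (1 : R) (\sum_(i < k.+1) \sum_(l < k.+1)
   ((fun s => r s (node i)) * (fun s => r s (node l)) * cst (J (L i * L l))))
   (2 * \int[mu]_(y in `[a, b]) (dr s y * r s y)).
  apply: is_derive_eq.
  have -> : \int[mu]_(y in `[a, b]) (dr s y * r s y) =
      J ((\sum_(i < k.+1) dr s (node i) *: L i)
         * (\sum_(i < k.+1) r s (node i) *: L i)).
    apply: eq_Rintegral_oo.
      apply: continuous_cellM; last exact/poly_on_cell/r_poly.
      exact/poly_on_cell/poly_on_time_derivative.
    by move=> y yab; rewrite hornerM -dr_nodes// -r_nodes.
  (* The factor 2 supplies two copies of the double sum. Exchanging the indices in one of them, by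
     symmetry of the Gram matrix, produces the second term of the product rule. *)
  rewrite quad mulr_natl mulr2n [X in _ = _ + X]exchange_big -big_split/=.
  apply: eq_bigr => i _; rewrite -big_split/=; apply: eq_bigr => l _.
  by rewrite [L l * L i]mulrC mulrDl.
apply: near_eq_is_derive dE.
have := near_in_itvoo sT; apply: filterS => s' s'T.
rewrite energy_nodes ?fct_sumE//; last exact: subset_itv_oo_cc.
by apply: eq_bigr => i _; rewrite fct_sumE.
Qed.

End time_derivative_of_energy.

(** * Taylor polynomials *)

Section taylor_in_space.
Set Implicit Arguments.
Unset Strict Implicit.
Variable R : realType.
Notation mu := (@lebesgue_measure R).

Lemma bounded_on_rectangle (T yL yR : R) (f : R -> R -> R) :
  {within [set z : R * R | z.1 \in `[0, T] /\ z.2 \in `[yL, yR]],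
     continuous (fun z : R * R => f z.1 z.2)} ->
  exists M : R, {in `[0, T] & `[yL, yR], forall s y, `|f s y| <= M}.
Proof.
move=> cf.
have [M [_ HM]] : bounded_set ((fun z : R * R => f z.1 z.2) @`
    [set z : R * R | z.1 \in `[0, T] /\ z.2 \in `[yL, yR]]).
  apply: (@compact_bounded R R^o); apply: continuous_compact => //.
  by apply: (@compact_setX _ _ `[0, T]%classic `[yL, yR]%classic); exact: segment_compact.
(* [bounded_set] provides a bound by every real strictly above [M], hence the added 1. *)
exists (M + 1) => s y sT yI; apply: (HM (M + 1)); first by rewrite ltrDl.
by exists (s, y).
Qed.

Lemma Rintegral_FTC (a b : R) (f F : R -> R) : a <= b ->
  {within `[a, b], continuous f} -> {within `[a, b], continuous F} ->
  {in `]a, b[, forall y, is_derive y (1 : R) F (f y)} ->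
  \int[mu]_(y in `[a, b]) f y = F b - F a.
Proof.
rewrite le_eqVlt => /predU1P[->|ab] cf cF dF.
  by rewrite set_itv1 Rintegral_set1 subrr.
rewrite /Rintegral (@continuous_FTC2 _ f F a b)//.
  have /(continuous_within_itvP _ ab)[_ Fa Fb] := cF; split => // y yab.
  by have := dF y yab => dFy; exact: ex_derive.
by move=> y yab; have := dF y yab => dFy; rewrite derive1E derive_val.
Qed.

(** The derivatives at [a] come as a bare sequence [c], so that differentiating the polynomial
    amounts to shifting [c]. There are [n] terms, hence degree below [n]. *)
Definition taylor_poly (n : nat) (c : nat -> R) (a : R) : {poly R} :=
  \sum_(i < n) (c i / (i`!)%:R) *: ('X - a%:P) ^+ i.

Lemma size_taylor_poly n c a : (size (taylor_poly n c a) <= n)%N.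
Proof.
apply: leq_trans (size_sum _ _ _) _; apply/bigmax_leqP => i _.
by rewrite (leq_trans (size_scale_leq _ _))// size_exp_XsubC.
Qed.

Lemma deriv_taylor_poly n c a :
  deriv (taylor_poly n.+1 c a) = taylor_poly n (c \o S) a.
Proof.
rewrite /taylor_poly big_ord_recl/= derivD expr0 derivZ.
rewrite -[X in X^`()%R]/(1%:P) derivC scaler0 add0r raddf_sum/=.
apply: eq_bigr => i _; rewrite derivZ deriv_exp derivXsubC mul1r /bump/= add1n/=.
rewrite -[X in _ *: X]scaler_nat scalerA; congr (_ *: _).
by rewrite factS natrM -mulrA invfM [X in _ * X]mulrAC mulVf ?mul1r// pnatr_eq0.
Qed.

Lemma horner_taylor_poly n c a : (taylor_poly n.+1 c a).[a] = c 0%N.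
Proof.
rewrite /taylor_poly big_ord_recl/= hornerD horner_sum big1 => [|i _].
  by rewrite expr0 hornerZ hornerC addr0 fact0 divr1 mulr1.
by rewrite hornerZ horner_exp hornerXsubC subrr expr0n mulr0.
Qed.

(** The derivative of the remainder is the remainder of one order less for the shifted sequence, so
    the mean value theorem drives an induction on [n]. Each use costs a factor [y - a], the
    intermediate point being no farther from [a] than [y]; the factorial is given up. *)
Lemma taylor_remainder (n : nat) (a b M : R) (f : nat -> R -> R) :
  (forall i, {within `[a, b], continuous (f i)}) ->
  (forall i, {in `]a, b[, forall y, is_derive y (1 : R) (f i) (f i.+1 y)}) ->
  {in `[a, b], forall y, `|f n y| <= M} ->
  {in `[a, b], forall y,
    `|f 0%N y - (taylor_poly n (f ^~ a) a).[y]| <= M * (y - a) ^+ n}.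
Proof.
elim: n f => [|n IHn] f cf df fM y yab.
  by rewrite /taylor_poly big_ord0 horner0 subr0 expr0 mulr1; exact: fM.
have /andP[ay yb] : a <= y <= b by move: yab; rewrite in_itv.
have M0 : 0 <= M by apply: le_trans (fM _ yab).
pose p := taylor_poly n.+1 (f ^~ a) a.
have dp z : is_derive z (1 : R) (horner p) (taylor_poly n (f^~ a \o S) a).[z].
  apply: DeriveDef; first exact: derivable_horner.
  by rewrite -derive1E -derivE deriv_taylor_poly.
have [z|t|c cay] := @MVT_segment _ (f 0%N - horner p)
    (fun z => f 1%N z - (taylor_poly n (f^~ a \o S) a).[z]) a y ay.
- rewrite in_itv/= => /andP[az zy].
  have := df 0%N z; rewrite in_itv/= az (lt_le_trans zy yb) => /(_ isT) dfz.
  exact: is_deriveB.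
- apply: (@cvgB _ R^o); last exact: within_continuous_horner.
  have c0 : {within `[a, y], continuous (f 0%N)}.
    apply: continuous_subspaceW (cf 0%N).
    by apply: subset_itvl; rewrite bnd_simp.
  exact: c0.
move: cay; rewrite in_itv/= => /andP[ac cy].
rewrite !fctE horner_taylor_poly subrr subr0 -/p => ->.
rewrite normrM (ger0_norm (_ : 0 <= y - a)) ?subr_ge0// exprSr mulrA.
rewrite ler_wpM2r ?subr_ge0//.
have := IHn (fun i => f i.+1) (fun i => cf i.+1) (fun i => df i.+1) fM c.
rewrite in_itv/= ac (le_trans cy yb) => /(_ isT) /le_trans; apply.
by rewrite ler_wpM2l// lerXn2r ?nnegrE ?subr_ge0// lerB.
Qed.
End taylor_in_space.

(** * Approximation of smooth functions *)

Section smooth_functions.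
Set Implicit Arguments.
Unset Strict Implicit.
Variable R : realType.
Variables (T yL yR : R) (f : R -> R -> R).
Hypothesis f_smooth : smooth_on T yL yR f.

Lemma smooth_bounded : exists M : R,
  {in `[0, T] & `[yL, yR], forall s y, `|f s y| <= M}.
Proof.
have [d [d0 /(_ 0%N 0%N)[cd _]]] := f_smooth.
have [M dM] := bounded_on_rectangle cd.
by exists M => s y sT yI; rewrite -d0//; exact: dM.
Qed.

Lemma smooth_continuous_space :
  {in `[0, T], forall s, {within `[yL, yR], continuous (f s)}}.
Proof.
have [d [d0 /(_ 0%N 0%N)[_ dd]]] := f_smooth.
move=> s sT; apply: (@subspace_eq_continuous _ _ _ (d 0%N 0%N s)).
  by move=> y; rewrite inE => yI; exact: d0.
by apply: derivable_on_continuous => y yI; have [] := dd _ _ sT yI.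
Qed.

Lemma smooth_is_derive_space : {in `[0, T] & `]yL, yR[, forall s y,
  is_derive y (1 : R) (f s) (derive_on yL yR (f s) y)}.
Proof.
have [d [d0 /(_ 0%N 0%N)[_ dd]]] := f_smooth.
move=> s y sT yI; have yI' : y \in `[yL, yR] by exact: subset_itv_oo_cc.
apply: (@near_eq_is_derive _ _ _ (d 0%N 0%N s)).
  have := near_in_itvoo yI; apply: filterS => z zI; apply: d0 => //.
  exact: subset_itv_oo_cc.
rewrite (@derive_on_eq _ _ _ (f s) (d 0%N 0%N s))//.
  by apply: derivable_on_is_derive => //; have [] := dd _ _ sT yI'.
by move=> z zI; rewrite d0.
Qed.

(** The error equations involve the time derivative of the approximant, and closeness of values says
    nothing about it; hence [dq] is part of the data, with its own estimate. *)
Record polynomial_approximation (k : nat) (a b K : R) (q dq : R -> R -> R) :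
    Prop := PolynomialApproximation {
  approx_poly : forall s, poly_on k.+1 a b (q s) ;
  approx_continuous : forall y, {within `[0, T], continuous (q ^~ y)} ;
  approx_is_derive : {in `]0, T[, forall s, forall y,
    is_derive s (1 : R) (q ^~ y) (dq s y)} ;
  approx_le : {in `[0, T] & `[a, b], forall s y,
    `|f s y - q s y| <= K * (b - a) ^+ k.+1} ;
  approx_derive_le : {in `]0, T[ & `[a, b], forall s y,
    `|derive_on 0 T (f ^~ y) s - dq s y| <= K * (b - a) ^+ k.+1} }.

(* Taylor expansion in space: unlike the L2 projection, it visibly commutes
   with the time derivative. *)
Lemma smooth_approximation (k : nat) : exists2 K : R, 0 <= K &
  forall a b, yL <= a -> a < b -> b <= yR ->
    exists q dq, polynomial_approximation k a b K q dq.
Proof.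
have [d [d0 dP]] := f_smooth.
have [M0 dM0] := bounded_on_rectangle (dP k.+1 0%N).1.
have [M1 dM1] := bounded_on_rectangle (dP k.+1 1%N).1.
(* [M0] bounds the space derivative of order [k.+1] of [f], and [M1] that of its time derivative.
   Neither depends on the cell. *)
exists (`|M0| + `|M1|) => [|a b ya ab yb]; first by rewrite addr_ge0.
have abI : {subset `[a, b] <= `[yL, yR]}.
  move=> y; rewrite !in_itv/= => /andP[ay yb'].
  by rewrite (le_trans ya)//= (le_trans yb').
have abI' : {subset `]a, b[ <= `]yL, yR[}.
  move=> y; rewrite !in_itv/= => /andP[ay yb'].
  by rewrite (le_lt_trans ya)//= (lt_le_trans yb').
have aI : a \in `[yL, yR] by apply: abI; rewrite in_itv/= lexx ltW.
(* [P j s] expands the [j]-th time derivative at the left end of the cell. As [d i 1] is the time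
   derivative of [d i 0], the coefficients of [P 1] are those of [P 0] differentiated in time. *)
pose P j s := taylor_poly k.+1 (fun i => d i j s a) a.
have PE j s y : (P j s).[y] = \sum_(i < k.+1) d i j s a * ((y - a) ^+ i / (i`!)%:R).
  rewrite horner_sum; apply: eq_bigr => i _.
  by rewrite hornerZ horner_exp hornerXsubC mulrAC mulrA.
have rem j M : {in `[0, T] & `[yL, yR], forall s y, `|d k.+1 j s y| <= M} ->
    M <= `|M0| + `|M1| -> {in `[0, T] & `[a, b], forall s y,
    `|d 0%N j s y - (P j s).[y]| <= (`|M0| + `|M1|) * (b - a) ^+ k.+1}.
  move=> dM MK s y sT yab.
  apply: (@le_trans _ _ (M * (y - a) ^+ k.+1)).
    apply: (@taylor_remainder _ k.+1 a b M (fun i => d i j s)) => //.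
    - move=> i; have ci : {within `[yL, yR], continuous (d i j s)}.
        by apply: derivable_on_continuous => z zI; have [] := (dP i j).2 _ _ sT zI.
      by apply: continuous_subspaceW ci => z; exact: abI.
    - move=> i z zab; have zI : z \in `[yL, yR] by apply/abI/subset_itv_oo_cc.
      have [h1 <- _ _] := (dP i j).2 _ _ sT zI.
      by apply: derivable_on_is_derive => //; exact: abI'.
    - by move=> z zab; apply: dM => //; exact: abI.
  move: yab; rewrite in_itv/= => /andP[ay yb'].
  apply: ler_pM => //.
  - apply: le_trans (dM s a sT aI) => //.
  - by rewrite exprn_ge0// subr_ge0.
  - by rewrite lerXn2r ?nnegrE ?subr_ge0 ?lerB// ltW.
exists (fun s y => (P 0%N s).[y]), (fun s y => (P 1%N s).[y]); split.
- by move=> s; exists (P 0%N s) => //; exact: size_taylor_poly.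
- move=> y; under [X in {within _, continuous X}]funext do rewrite PE.
  apply: within_continuous_sum => i t; apply: cvgM; last exact: cvg_cst.
  have : {within `[0, T], continuous (fun s => d i 0%N s a)}.
    by apply: derivable_on_continuous => s sT; have [] := (dP i 0%N).2 _ _ sT aI.
  exact.
- move=> s sT y; have sT' : s \in `[0, T] by exact: subset_itv_oo_cc.
  have -> : (fun s => (P 0%N s).[y]) =
     \sum_(i < k.+1) (fun s => d i 0%N s a) * cst ((y - a) ^+ i / (i`!)%:R).
    by apply/funext => s'; rewrite PE fct_sumE.
  rewrite PE; apply: is_derive_sum => i.
  have di : is_derive s (1 : R) (fun s => d i 0%N s a) (d i 1%N s a).
    have [_ _ h1 <-] := (dP i 0%N).2 _ _ sT' aI.
    exact: derivable_on_is_derive.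
  by apply: is_derive_eq; rewrite scaler0 add0r [RHS]mulrC.
- move=> s y sT yab; rewrite -d0//; last exact: abI.
  by apply: (rem 0%N M0) => //; rewrite (le_trans (ler_norm _))// lerDl.
- move=> s y sT yab; have sT' : s \in `[0, T] by exact: subset_itv_oo_cc.
  rewrite (@derive_on_eq _ _ _ _ (fun s' => d 0%N 0%N s' y))//; last first.
    by move=> s' s'T; rewrite d0//; exact: abI.
  have [_ _ _ ->] := (dP 0%N 0%N).2 _ _ sT' (abI _ yab).
  by apply: (rem 1%N M1) => //; rewrite (le_trans (ler_norm _))// lerDr.
Qed.
End smooth_functions.

(** * Norms as integrals *)

Section norms.
Set Implicit Arguments.
Unset Strict Implicit.
Variable R : realType.
Implicit Types (a b c : R) (f : R -> R).
Notation mu := (@lebesgue_measure R).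

Lemma norm_L2E a b f :
  mu.-integrable `[a, b] (EFin \o (fun y => f y ^+ 2)) ->
  norm_L2 a b f = (Num.sqrt (\int[mu]_(y in `[a, b]) (f y ^+ 2)))%:E.
Proof.
move=> if2; have if2' : mu.-integrable `]a, b[ (EFin \o (fun y => f y ^+ 2)).
  by apply: (@integrableS _ _ _ mu `[a, b]) => //; exact: subset_itv_oo_cc.
have I0 : 0 <= \int[mu]_(y in `[a, b]) (f y ^+ 2).
  by apply: Rintegral_ge0 => y _; exact: sqr_ge0.
rewrite -powR12_sqrt// /norm_L2 /Lp_norm_on unlock -poweR_EFin; congr (_ `^ _)%E.
rewrite /Rintegral fineK; last exact: integrable_fin_num.
rewrite integral_itv_bndoo; last exact: (measurable_int mu).
rewrite [RHS]integral_mkcond; apply: eq_integral => y _ /=.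
rewrite !patchE; case: ifPn => _; last by rewrite normr0 powR0.
by rewrite powR_mulrn// -normrX ger0_norm// sqr_ge0.
Qed.

Lemma norm_L2_le a b c f :
  mu.-integrable `[a, b] (EFin \o (fun y => f y ^+ 2)) -> 0 <= c ->
  \int[mu]_(y in `[a, b]) (f y ^+ 2) <= c ^+ 2 -> (norm_L2 a b f <= c%:E)%E.
Proof.
move=> if2 c0 fc; rewrite norm_L2E// lee_fin (le_trans (ler_wsqrtr fc))//.
by rewrite sqrtr_sqr ger0_norm.
Qed.

Lemma norm_L2_ge a b c f :
  mu.-integrable `[a, b] (EFin \o (fun y => f y ^+ 2)) ->
  (norm_L2 a b f <= c%:E)%E -> \int[mu]_(y in `[a, b]) (f y ^+ 2) <= c ^+ 2.
Proof.
move=> if2; rewrite norm_L2E// lee_fin => h.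
have I0 : 0 <= \int[mu]_(y in `[a, b]) (f y ^+ 2).
  by apply: Rintegral_ge0 => y _; exact: sqr_ge0.
rewrite -[leLHS]sqr_sqrtr// lerXn2r ?nnegrE ?sqrtr_ge0//.
by rewrite (le_trans _ h)// sqrtr_ge0.
Qed.

Lemma norm_Loo_le a b c f : 0 <= c -> {in `]a, b[, forall y, `|f y| <= c} ->
  (norm_Loo a b f <= c%:E)%E.
Proof.
move=> c0 fc; rewrite /norm_Loo /Lp_norm_on unlock.
case: ifPn => _; last by rewrite lee_fin.
apply/ess_supP/nearW => y /=; rewrite lee_fin patchE; case: ifPn => [|_].
  by rewrite inE; exact: fc.
by rewrite normr0.
Qed.

End norms.

(** * The scheme *)

Section square_estimates.
Set Implicit Arguments.
Unset Strict Implicit.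
Variable R : realType.
Implicit Types (a b c y eta : R) (f g h : R -> R).
Notation mu := (@lebesgue_measure R).

(** Turns L2 control into pointwise control: both [uh - u s yR] and [u - uh] are, up to sign,
    integrals from [y] to [yR]. Both the length and the integral of the square only grow when
    passing from [[y, b]] to [[a, b]]. *)
Lemma sqr_Rintegral_tail_le a b y f : a <= y -> y <= b ->
  mu.-integrable `[a, b] (EFin \o f) ->
  mu.-integrable `[a, b] (EFin \o (fun z => f z ^+ 2)) ->
  (\int[mu]_(z in `[y, b]) f z) ^+ 2
    <= (b - a) * \int[mu]_(z in `[a, b]) (f z ^+ 2).
Proof.
move=> ay yb if1 if2.
have yab : `[y, b] `<=` `[a, b] by apply: subset_itv; rewrite bnd_simp.
have I0 (c d : R) : 0 <= \int[mu]_(z in `[c, d]) (f z ^+ 2).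
  by apply: Rintegral_ge0 => z _; exact: sqr_ge0.
have ab : 0 <= b - a by rewrite subr_ge0 (le_trans ay).
move: (yb); rewrite le_eqVlt => /predU1P[->|ltyb].
  by rewrite set_itv1 Rintegral_set1 expr0n/= mulr_ge0.
apply: (@le_trans _ _ ((b - y) * \int[mu]_(z in `[y, b]) (f z ^+ 2))).
  by apply: sqr_Rintegral_le => //; apply: (@integrableS _ _ _ mu `[a, b]).
rewrite ler_pM ?subr_ge0 ?lerB//.
by rewrite (Rintegral_itv_cat ay yb if2) lerDr.
Qed.

(** Exchanges the exact function for its Taylor polynomial in a squared error, at the cost of the
    remainder [eta]. It is used in both directions: at time 0 to bound the discrete error, and at
    time [s] to return to the true one. *)
Lemma sqr_dist_Rintegral_le a b eta f g h : a <= b ->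
  continuous_cell a b f -> continuous_cell a b g -> continuous_cell a b h ->
  {in `]a, b[, forall y, `|f y - h y| <= eta} ->
  \int[mu]_(y in `[a, b]) ((f y - g y) ^+ 2)
    <= 2 * \int[mu]_(y in `[a, b]) ((h y - g y) ^+ 2) + 2 * eta ^+ 2 * (b - a).
Proof.
move=> ab cf cg ch fh.
have chg : continuous_cell a b (fun y => (h y - g y) ^+ 2).
  exact/continuous_cellX2/continuous_cellB.
have c2 : continuous_cell a b (fun y => 2 * (h y - g y) ^+ 2).
  by apply: continuous_cellM chg; exact: continuous_cell_cst.
have c3 := @continuous_cell_cst _ a b (2 * eta ^+ 2).
rewrite -(Rintegral_cst_itv (2 * eta ^+ 2) ab) -RintegralZl//; last first.
  exact: continuous_cell_integrable.
rewrite -RintegralD//; [|exact: continuous_cell_integrable..].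
apply: le_Rintegral_oo.
- exact/continuous_cellX2/continuous_cellB.
- exact: continuous_cellD.
move=> y yab; set A := h y - g y; have := fh y yab; set B := f y - h y => Be.
have -> : f y - g y = A + B by rewrite /A /B; ring.
have : B ^+ 2 <= eta ^+ 2.
  by rewrite -real_normK ?num_real// lerXn2r ?nnegrE ?(le_trans _ Be).
by have := sqr_ge0 (A - B); lra.
Qed.

End square_estimates.

Section scheme.
Set Implicit Arguments.
Unset Strict Implicit.
Variable R : realType.
Notation mu := (@lebesgue_measure R).
Variables (k : nat) (T yL yR : R) (u : R -> R -> R) (N : nat) (x : nat -> R).
Variables (uh rhoh omegah : R -> R -> R).
Hypothesis x_mesh : is_mesh yL yR N x.
Hypothesis h_sol : idg_solution k T yL yR u N x uh rhoh omegah.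

Let x_incr : forall j, (j < N)%N -> x j < x j.+1.
Proof. by case: x_mesh. Qed.

Let x0 : x 0%N = yL. Proof. by case: x_mesh. Qed.
Let xN : x N = yR. Proof. by case: x_mesh. Qed.

Let omegah_cell (s : R) j : s \in `[0, T] -> (j < N)%N ->
  continuous_cell (x j) (x j.+1) (omegah s).
Proof.
by move=> sT jN; apply: poly_on_cell; exact: (omegah_space h_sol sT jN).
Qed.

(** The scheme recovers [uh] from the right end of each cell. Replacing [yR] by an arbitrary
    interface [x n] allows an induction that chains these local formulas. *)
Lemma uhE (s y : R) : s \in `[0, T] -> y \in `[yL, yR] ->
  uh s y = u s yR - \int[mu]_(z in `[y, yR]) omegah s z.
Proof.
move=> sT; rewrite -(uh_boundary h_sol sT) -xN -x0.
suff H n : (n <= N)%N -> y \in `[x 0%N, x n] ->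
    uh s y = uh s (x n) - \int[mu]_(z in `[y, x n]) omegah s z by exact: H.
elim: n => [_|n IHn nN].
  rewrite in_itv/= -eq_le => /eqP <-.
  by rewrite set_itv1 Rintegral_set1 subr0.
rewrite in_itv/= => /andP[xy yx].
have [ynx|xny] := leP y (x n); last first.
  by apply: (scheme_u h_sol nN sT); rewrite in_itv/= yx ltW.
rewrite (IHn (ltnW nN)) ?in_itv/= ?xy//.
rewrite (scheme_u h_sol nN sT (y := x n)); last first.
  by rewrite in_itv/= lexx ltW// x_incr.
have xnn : x n <= x n.+1 by rewrite ltW// x_incr.
rewrite (Rintegral_itv_cat ynx xnn); first by rewrite opprD addrA addrAC.
have [omi _] := mesh_integral x_incr nN (fun j => @omegah_cell s j sT).
apply: (@integrableS _ _ _ mu `[x 0%N, x n.+1]) => //.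
by apply: subset_itv; rewrite bnd_simp.
Qed.

Let dt (v : R -> R -> R) (s y : R) := derive_on 0 T (v ^~ y) s.

(** The function [v] is controlled on one cell only, whereas the scheme is tested against members of
    [dg_space]. The polynomial that represents [v] there, taken on the whole line, is such a
    member. *)
Lemma scheme_rho_test (s : R) j v : s \in `[0, T] -> (j < N)%N ->
  continuous_cell (x j) (x j.+1) (dt rhoh s) ->
  poly_on k.+1 (x j) (x j.+1) v ->
  \int[mu]_(y in `[x j, x j.+1]) (dt rhoh s y * v y)
    = - \int[mu]_(y in `[x j, x j.+1]) (uh s y * omegah s y * v y).
Proof.
move=> sT jN cdt vp; have cv := poly_on_cell vp.
have cu : continuous_cell (x j) (x j.+1) (uh s).
  by apply: poly_on_cell; exact: (uh_space h_sol sT jN).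
have [p sp pE] := vp.
have := @scheme_rho _ _ _ _ _ _ _ _ _ _ _ h_sol s (horner p) j sT _ jN.
have dgp : dg_space N x k (horner p) by move=> i _; exists p.
move=> /(_ dgp)/eqP; rewrite addr_eq0 => /eqP E.
rewrite (eq_Rintegral_oo (f := fun y => dt rhoh s y * v y)
  (g := fun y => dt rhoh s y * p.[y])).
- rewrite (eq_Rintegral_oo (f := fun y => uh s y * omegah s y * v y)
    (g := fun y => uh s y * omegah s y * p.[y])).
  + exact: E.
  + apply: continuous_cellM => //; apply: continuous_cellM => //.
    exact: omegah_cell.
  + by move=> y yab; rewrite pE.
- exact: continuous_cellM.
- by move=> y yab; rewrite pE.
Qed.

Lemma scheme_omega_test (s : R) j v : s \in `[0, T] -> (j < N)%N ->
  continuous_cell (x j) (x j.+1) (dt omegah s) ->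
  poly_on k.+1 (x j) (x j.+1) v ->
  \int[mu]_(y in `[x j, x j.+1]) (dt omegah s y * v y)
    = \int[mu]_(y in `[x j, x j.+1]) (rhoh s y * uh s y * v y).
Proof.
move=> sT jN cdt vp; have cv := poly_on_cell vp.
have cu : continuous_cell (x j) (x j.+1) (uh s).
  by apply: poly_on_cell; exact: (uh_space h_sol sT jN).
have cr : continuous_cell (x j) (x j.+1) (rhoh s).
  by apply: poly_on_cell; exact: (rhoh_space h_sol sT jN).
have [p sp pE] := vp.
have dgp : dg_space N x k (horner p) by move=> i _; exists p.
have E := scheme_omega h_sol sT dgp jN.
rewrite (eq_Rintegral_oo (f := fun y => dt omegah s y * v y)
  (g := fun y => dt omegah s y * p.[y])).
- rewrite (eq_Rintegral_oo (f := fun y => rhoh s y * uh s y * v y)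
    (g := fun y => rhoh s y * uh s y * p.[y])).
  + exact: E.
  + by apply: continuous_cellM => //; exact: continuous_cellM.
  + by move=> y yab; rewrite pE.
- exact: continuous_cellM.
- by move=> y yab; rewrite pE.
Qed.


Lemma rhoh_continuous (j : nat) (y : R) : (j < N)%N -> y \in `]x j, x j.+1[ ->
  {within `[0, T], continuous (rhoh ^~ y)}.
Proof.
by move=> jN yab; apply: derivable_on_continuous => s sT;
  exact: (derivable_rhoh h_sol jN sT yab).
Qed.

Lemma omegah_continuous (j : nat) (y : R) : (j < N)%N -> y \in `]x j, x j.+1[ ->
  {within `[0, T], continuous (omegah ^~ y)}.
Proof.
by move=> jN yab; apply: derivable_on_continuous => s sT;
  exact: (derivable_omegah h_sol jN sT yab).
Qed.

Lemma rhoh_is_derive (j : nat) (s y : R) : (j < N)%N -> s \in `]0, T[ ->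
  y \in `]x j, x j.+1[ -> is_derive s (1 : R) (rhoh ^~ y) (dt rhoh s y).
Proof.
move=> jN sT yab; apply: derivable_on_is_derive => //.
by apply: (derivable_rhoh h_sol jN _ yab); exact: subset_itv_oo_cc.
Qed.

Lemma omegah_is_derive (j : nat) (s y : R) : (j < N)%N -> s \in `]0, T[ ->
  y \in `]x j, x j.+1[ -> is_derive s (1 : R) (omegah ^~ y) (dt omegah s y).
Proof.
move=> jN sT yab; apply: derivable_on_is_derive => //.
by apply: (derivable_omegah h_sol jN _ yab); exact: subset_itv_oo_cc.
Qed.

Lemma dt_rhoh_poly (j : nat) (s : R) : (j < N)%N -> s \in `]0, T[ ->
  poly_on k.+1 (x j) (x j.+1) (dt rhoh s).
Proof.
move=> jN sT; apply: (poly_on_time_derivative (x_incr jN) (T := T) (r := rhoh)) => //.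
- by move=> s' s'T; exact: (rhoh_space h_sol s'T jN).
- by move=> s' y s'T yab; exact: rhoh_is_derive jN s'T yab.
Qed.

Lemma dt_omegah_poly (j : nat) (s : R) : (j < N)%N -> s \in `]0, T[ ->
  poly_on k.+1 (x j) (x j.+1) (dt omegah s).
Proof.
move=> jN sT; apply: (poly_on_time_derivative (x_incr jN) (T := T) (r := omegah)) => //.
- by move=> s' s'T; exact: (omegah_space h_sol s'T jN).
- by move=> s' y s'T yab; exact: omegah_is_derive jN s'T yab.
Qed.

Lemma discrete_energy_le (j : nat) (s : R) : (j < N)%N -> s \in `[0, T] ->
  \int[mu]_(y in `[x j, x j.+1]) (rhoh s y ^+ 2)
    + \int[mu]_(y in `[x j, x j.+1]) (omegah s y ^+ 2)
  <= \int[mu]_(y in `[x j, x j.+1]) (rhoh 0 y ^+ 2)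
    + \int[mu]_(y in `[x j, x j.+1]) (omegah 0 y ^+ 2).
Proof.
move=> jN sT; have ab := x_incr jN.
pose F := (fun s => \int[mu]_(y in `[x j, x j.+1]) (rhoh s y ^+ 2))
  + (fun s => \int[mu]_(y in `[x j, x j.+1]) (omegah s y ^+ 2)).
have rp : {in `[0, T], forall s, poly_on k.+1 (x j) (x j.+1) (rhoh s)}.
  by move=> s' s'T; exact: (rhoh_space h_sol s'T jN).
have wp : {in `[0, T], forall s, poly_on k.+1 (x j) (x j.+1) (omegah s)}.
  by move=> s' s'T; exact: (omegah_space h_sol s'T jN).
have dF (r : R) : r \in `]0, T[ -> is_derive r (1 : R) F 0.
  move=> rT; have rT' : r \in `[0, T] by exact: subset_itv_oo_cc.
  have d1 := energy_is_derive ab rp (fun s y sT yab => rhoh_is_derive jN sT yab) rT.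
  have d2 := energy_is_derive ab wp (fun s y sT yab => omegah_is_derive jN sT yab) rT.
  apply: is_derive_eq.
  have cr := poly_on_cell (rp r rT'); have cw := poly_on_cell (wp r rT').
  (* Tested with [rhoh] and [omegah] respectively, the two equations contribute opposite integrals
     of [uh * omegah * rhoh]. *)
  rewrite scheme_rho_test//; [|exact/poly_on_cell/dt_rhoh_poly|exact: rp].
  rewrite scheme_omega_test//; [|exact/poly_on_cell/dt_omegah_poly|exact: wp].
  rewrite mulrN addrC -mulrBr; apply/eqP; rewrite mulf_eq0 pnatr_eq0/= subr_eq0.
  by apply/eqP/eq_Rintegral => y _; ring.
have cF : {within `[0, T], continuous F}.
  move=> r; apply: (@cvgD _ R^o).
    exact: (energy_continuous ab rp (fun y yab => rhoh_continuous jN yab)).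
  exact: (energy_continuous ab wp (fun y yab => omegah_continuous jN yab)).
have T0 : 0 <= T by move: sT; rewrite in_itv/= => /andP[/le_trans]; apply.
suff : F s <= F 0 by [].
apply: (@ler0_derive1_le_cc _ F 0 T) => //.
- by move=> r rT; have := dF r rT => dFr; exact: ex_derive.
- by move=> r rT; have := dF r rT => dFr; rewrite derive1E derive_val.
- by rewrite in_itv/= lexx.
- by move: sT; rewrite in_itv/= => /andP[].
Qed.

End scheme.

(** * The error estimate *)

Section error_estimate.
Set Implicit Arguments.
Unset Strict Implicit.
Variable R : realType.
Notation mu := (@lebesgue_measure R).

Lemma sqr_le_of_norm (a b : R) : `|a| <= b -> a ^+ 2 <= b ^+ 2.
Proof.
by move=> ab; rewrite -real_normK ?num_real// lerXn2r ?nnegrE ?(le_trans _ ab).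
Qed.

(* The terms in which [v] multiplies two discrete errors cancel. *)
Lemma energy_density_le (u v w r wh rh qw qr dqw dqr B M U eta : R) :
  `|v| <= B -> `|w| <= M -> `|r| <= M -> (u - v) ^+ 2 <= U ->
  `|r - qr| <= eta -> `|w - qw| <= eta ->
  `|- (u * w) - dqr| <= eta -> `|r * u - dqw| <= eta ->
  2 * ((dqr + v * wh) * (qr - rh) + (dqw - rh * v) * (qw - wh))
  <= (qr - rh) ^+ 2 + (qw - wh) ^+ 2
     + 4 * (M ^+ 2 * U + ((1 + B) * eta) ^+ 2).
Proof.
move=> vB wM rM uU re we dre dwe.
have B0 : 0 <= B by exact: le_trans vB.
have sqr_le (A1 A2 : R) : A1 ^+ 2 <= M ^+ 2 * U -> `|A2| <= (1 + B) * eta ->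
    (A1 + A2) ^+ 2 <= 2 * (M ^+ 2 * U + ((1 + B) * eta) ^+ 2).
  move=> h1 /sqr_le_of_norm h2; have := sqr_ge0 (A1 - A2); lra.
have U_le (z : R) : `|z| <= M -> ((u - v) * z) ^+ 2 <= M ^+ 2 * U.
  by move=> /sqr_le_of_norm zM; rewrite exprMn mulrC ler_pM ?sqr_ge0.
have eta_le (d e : R) : `|d| <= eta -> `|e| <= eta -> `|d + v * e| <= (1 + B) * eta.
  move=> d_le e_le; rewrite mulrDl mul1r (le_trans (ler_normD _ _))// lerD//.
  by rewrite normrM ler_pM.
have h1 : (dqr + v * qw) ^+ 2 <= 2 * (M ^+ 2 * U + ((1 + B) * eta) ^+ 2).
  (* The residual of the approximants in the equation for [rho]: [u - v] times an exact quantity,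
     plus Taylor remainders. The exact equation is present through [- (u * w)], which stands for the
     time derivative of [rho]. *)
  have -> : dqr + v * qw = (u - v) * (- w) + - ((- (u * w) - dqr) + v * (w - qw)).
    by ring.
  by apply: sqr_le; [apply: U_le; rewrite normrN|rewrite normrN; exact: eta_le].
have h2 : (dqw - v * qr) ^+ 2 <= 2 * (M ^+ 2 * U + ((1 + B) * eta) ^+ 2).
  have -> : dqw - v * qr = (u - v) * r + - ((r * u - dqw) + v * - (r - qr)).
    by ring.
  by apply: sqr_le; [exact: U_le|rewrite normrN; apply: eta_le; rewrite ?normrN].
have -> : (dqr + v * wh) * (qr - rh) + (dqw - rh * v) * (qw - wh)
  = (dqr + v * qw) * (qr - rh) + (dqw - v * qr) * (qw - wh) by ring.
(* Twice the product of a residual and a discrete error is at most the sum of their squares; the two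
   residual bounds add up to the factor 4. *)
have := sqr_ge0 ((dqr + v * qw) - (qr - rh)).
have := sqr_ge0 ((dqw - v * qr) - (qw - wh)).
lra.
Qed.

Variables (k : nat) (T yL yR : R) (gL gR : R -> R) (u rho omega : R -> R -> R).
Hypothesis u_sol : smooth_solution T yL yR gL gR u rho omega.
Variables (N : nat) (x : nat -> R) (uh rhoh omegah : R -> R -> R).
Hypothesis x_mesh : is_mesh yL yR N x.
Hypothesis h_sol : idg_solution k T yL yR u N x uh rhoh omegah.


Let x_incr : forall j, (j < N)%N -> x j < x j.+1.
Proof. by case: x_mesh. Qed.

Let x0 : x 0%N = yL. Proof. by case: x_mesh. Qed.
Let xN : x N = yR. Proof. by case: x_mesh. Qed.

Let cell_sub j : (j < N)%N -> yL <= x j /\ x j.+1 <= yR.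
Proof.
move=> jN; rewrite -x0 -xN; split; apply: (mesh_le x_incr) => //.
  by rewrite leq0n ltnW.
by rewrite jN leqnn.
Qed.

Let mesh_integrable f :
  (forall j, (j < N)%N -> continuous_cell (x j) (x j.+1) f) ->
  mu.-integrable `[yL, yR] (EFin \o f).
Proof. by rewrite -x0 -xN => cf; have [] := mesh_integral x_incr (leqnn N) cf. Qed.

Let mesh_sum f :
  (forall j, (j < N)%N -> continuous_cell (x j) (x j.+1) f) ->
  \int[mu]_(y in `[yL, yR]) f y = \sum_(j < N) \int[mu]_(y in `[x j, x j.+1]) f y.
Proof. by rewrite -x0 -xN => cf; have [] := mesh_integral x_incr (leqnn N) cf. Qed.

Let smooth_cell f (s : R) j : smooth_on T yL yR f -> s \in `[0, T] -> (j < N)%N ->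
  continuous_cell (x j) (x j.+1) (f s).
Proof.
move=> sf sT jN; apply: continuous_cellW.
have [yx xy] := cell_sub jN.
apply: continuous_subspaceW (smooth_continuous_space sf sT).
by apply: subset_itv; rewrite bnd_simp.
Qed.

Let rhoh_poly (s : R) j : s \in `[0, T] -> (j < N)%N ->
  poly_on k.+1 (x j) (x j.+1) (rhoh s).
Proof. by move=> sT jN; exact: (rhoh_space h_sol sT jN). Qed.

Let omegah_poly (s : R) j : s \in `[0, T] -> (j < N)%N ->
  poly_on k.+1 (x j) (x j.+1) (omegah s).
Proof. by move=> sT jN; exact: (omegah_space h_sol sT jN). Qed.

Let uh_cell (s : R) j : s \in `[0, T] -> (j < N)%N ->
  continuous_cell (x j) (x j.+1) (uh s).
Proof. by move=> sT jN; apply: poly_on_cell; exact: (uh_space h_sol sT jN). Qed.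

Let rhoh_cell (s : R) j : s \in `[0, T] -> (j < N)%N ->
  continuous_cell (x j) (x j.+1) (rhoh s).
Proof. by move=> sT jN; exact/poly_on_cell/rhoh_poly. Qed.

Let omegah_cell (s : R) j : s \in `[0, T] -> (j < N)%N ->
  continuous_cell (x j) (x j.+1) (omegah s).
Proof. by move=> sT jN; exact/poly_on_cell/omegah_poly. Qed.

Let rho_error_cell (s : R) j : s \in `[0, T] -> (j < N)%N ->
  continuous_cell (x j) (x j.+1) (fun y => rho s y - rhoh s y).
Proof.
move=> sT jN; apply: continuous_cellB; last exact: rhoh_cell.
exact: (smooth_cell (smooth_rho u_sol)).
Qed.

Let omega_error_cell (s : R) j : s \in `[0, T] -> (j < N)%N ->
  continuous_cell (x j) (x j.+1) (fun y => omega s y - omegah s y).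
Proof.
move=> sT jN; apply: continuous_cellB; last exact: omegah_cell.
exact: (smooth_cell (smooth_omega u_sol)).
Qed.

Lemma rho_error_integrable (s : R) : s \in `[0, T] ->
  mu.-integrable `[yL, yR] (EFin \o (fun y => (rho s y - rhoh s y) ^+ 2)).
Proof.
by move=> sT; apply: mesh_integrable => j jN; exact/continuous_cellX2/rho_error_cell.
Qed.

Lemma omega_error_integrable (s : R) : s \in `[0, T] ->
  mu.-integrable `[yL, yR] (EFin \o (fun y => (omega s y - omegah s y) ^+ 2)).
Proof.
by move=> sT; apply: mesh_integrable => j jN; exact/continuous_cellX2/omega_error_cell.
Qed.

Lemma u_error_sqr_le (s y : R) : s \in `[0, T] -> y \in `[yL, yR] ->
  (u s y - uh s y) ^+ 2
    <= (yR - yL) * \int[mu]_(z in `[yL, yR]) ((omega s z - omegah s z) ^+ 2).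
Proof.
move=> sT yI; have /andP[yLy yyR] : yL <= y <= yR by move: yI; rewrite in_itv.
have sub : `[y, yR] `<=` `[yL, yR] by apply: subset_itv; rewrite bnd_simp.
have cw := smooth_continuous_space (smooth_omega u_sol) sT.
have cu := smooth_continuous_space (smooth_u u_sol) sT.
have uE : \int[mu]_(z in `[y, yR]) omega s z = u s yR - u s y.
  apply: Rintegral_FTC => //.
  - exact: continuous_subspaceW cw.
  - exact: continuous_subspaceW cu.
  - move=> z; rewrite in_itv/= => /andP[yz zR].
    have zI : z \in `]yL, yR[ by rewrite in_itv/= zR (le_lt_trans yLy).
    rewrite (eq_u u_sol sT zI).
    exact: (smooth_is_derive_space (smooth_u u_sol) sT zI).
have iw : mu.-integrable `[yL, yR] (EFin \o omega s).
  by apply: mesh_integrable => j; exact: smooth_cell (smooth_omega u_sol) sT.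
have iwh : mu.-integrable `[yL, yR] (EFin \o omegah s).
  by apply: mesh_integrable => j; exact: omegah_cell.
have -> : u s y - uh s y = - \int[mu]_(z in `[y, yR]) (omega s z - omegah s z).
  rewrite RintegralB//; [|exact: (@integrableS _ _ _ mu `[yL, yR])..].
  by rewrite uE (uhE x_mesh h_sol)//; ring.
rewrite sqrrN; apply: sqr_Rintegral_tail_le => //.
  by apply: mesh_integrable => j; exact: omega_error_cell.
exact: omega_error_integrable.
Qed.


Lemma uh_sqr_le (s y : R) : s \in `[0, T] -> y \in `[yL, yR] ->
  (uh s y - u s yR) ^+ 2 <= (yR - yL) * (\int[mu]_(z in `[yL, yR]) (rhoh 0 z ^+ 2)
    + \int[mu]_(z in `[yL, yR]) (omegah 0 z ^+ 2)).
Proof.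
move=> sT yI; have /andP[yLy yyR] : yL <= y <= yR by move: yI; rewrite in_itv.
have T0 : 0 \in `[0, T].
  by move: sT; rewrite !in_itv/= lexx => /andP[/le_trans]; apply.
rewrite (uhE x_mesh h_sol sT yI) addrAC subrr sub0r sqrrN.
have r2 s' : s' \in `[0, T] -> forall j, (j < N)%N ->
    continuous_cell (x j) (x j.+1) (fun y => rhoh s' y ^+ 2).
  by move=> s'T j jN; exact/continuous_cellX2/rhoh_cell.
have w2 s' : s' \in `[0, T] -> forall j, (j < N)%N ->
    continuous_cell (x j) (x j.+1) (fun y => omegah s' y ^+ 2).
  by move=> s'T j jN; exact/continuous_cellX2/omegah_cell.
apply: (@le_trans _ _ ((yR - yL) * \int[mu]_(z in `[yL, yR]) (omegah s z ^+ 2))).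
  apply: sqr_Rintegral_tail_le => //; last exact/mesh_integrable/w2.
  by apply: mesh_integrable => j; exact: omegah_cell.
rewrite ler_wpM2l ?subr_ge0 ?(le_trans yLy)//.
rewrite (mesh_sum (w2 s sT)) (mesh_sum (r2 0 T0)) (mesh_sum (w2 0 T0)) -big_split/=.
apply: ler_sum => j _.
apply: le_trans (discrete_energy_le x_mesh h_sol (ltn_ord j) sT).
by rewrite lerDr; apply: Rintegral_ge0 => z _; exact: sqr_ge0.
Qed.

(** * The energy inequality on one cell *)

Section cell.
Variables (j : nat) (K : R) (qr dqr qw dqw : R -> R -> R).
Hypothesis jN : (j < N)%N.
Hypothesis r_approx : polynomial_approximation T rho k (x j) (x j.+1) K qr dqr.
Hypothesis w_approx : polynomial_approximation T omega k (x j) (x j.+1) K qw dqw.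

(** The error is measured from the approximants rather than from the exact solution, so that it is
    polynomial on the cell and can serve as a test function. *)
Definition error_energy (s : R) : R :=
  \int[mu]_(y in `[x j, x j.+1]) ((qr s y - rhoh s y) ^+ 2)
  + \int[mu]_(y in `[x j, x j.+1]) ((qw s y - omegah s y) ^+ 2).

Let er (s y : R) := qr s y - rhoh s y.
Let ew (s y : R) := qw s y - omegah s y.
Let der (s y : R) := dqr s y - derive_on 0 T (rhoh ^~ y) s.
Let dew (s y : R) := dqw s y - derive_on 0 T (omegah ^~ y) s.

Definition error_energy_derivative (s : R) : R :=
  2 * \int[mu]_(y in `[x j, x j.+1]) (der s y * er s y)
  + 2 * \int[mu]_(y in `[x j, x j.+1]) (dew s y * ew s y).

Let er_poly : {in `[0, T], forall s, poly_on k.+1 (x j) (x j.+1) (er s)}.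
Proof.
move=> s sT; apply: poly_onB; first exact: approx_poly r_approx _.
exact: rhoh_poly.
Qed.

Let ew_poly : {in `[0, T], forall s, poly_on k.+1 (x j) (x j.+1) (ew s)}.
Proof.
move=> s sT; apply: poly_onB; first exact: approx_poly w_approx _.
exact: omegah_poly.
Qed.

Let er_diff : {in `]0, T[ & `]x j, x j.+1[, forall s y,
  is_derive s (1 : R) (er ^~ y) (der s y)}.
Proof.
move=> s y sT yab; apply: is_deriveB; first exact: approx_is_derive r_approx _ sT y.
exact: (rhoh_is_derive h_sol jN sT yab).
Qed.

Let ew_diff : {in `]0, T[ & `]x j, x j.+1[, forall s y,
  is_derive s (1 : R) (ew ^~ y) (dew s y)}.
Proof.
move=> s y sT yab; apply: is_deriveB; first exact: approx_is_derive w_approx _ sT y.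
exact: (omegah_is_derive h_sol jN sT yab).
Qed.

Let er_cont : {in `]x j, x j.+1[, forall y, {within `[0, T], continuous (er ^~ y)}}.
Proof.
move=> y yab s; apply: (@cvgB _ R^o); first exact: (approx_continuous r_approx).
exact: (rhoh_continuous h_sol jN yab).
Qed.

Let ew_cont : {in `]x j, x j.+1[, forall y, {within `[0, T], continuous (ew ^~ y)}}.
Proof.
move=> y yab s; apply: (@cvgB _ R^o); first exact: (approx_continuous w_approx).
exact: (omegah_continuous h_sol jN yab).
Qed.

Lemma error_energy_continuous : {within `[0, T], continuous error_energy}.
Proof.
move=> s; apply: (@cvgD _ R^o).
  exact: (energy_continuous (x_incr jN) er_poly er_cont).
exact: (energy_continuous (x_incr jN) ew_poly ew_cont).
Qed.

Lemma error_energy_is_derive (s : R) : s \in `]0, T[ ->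
  is_derive s (1 : R) error_energy (error_energy_derivative s).
Proof.
move=> sT; apply: is_deriveD.
  exact: (energy_is_derive (x_incr jN) er_poly er_diff sT).
exact: (energy_is_derive (x_incr jN) ew_poly ew_diff sT).
Qed.

(** The bound [U] on the squared error of [u] is left abstract because it is not local: it depends
    on the omega errors over the other cells, and is expressed through the energy only after
    summation. *)
Lemma error_energy_derivative_le (s B M U : R) : s \in `]0, T[ ->
  {in `[yL, yR], forall y, [/\ `|uh s y| <= B, `|omega s y| <= M,
    `|rho s y| <= M & (u s y - uh s y) ^+ 2 <= U]} ->
  error_energy_derivative s <= error_energy s
    + 4 * (M ^+ 2 * U + ((1 + B) * (K * (x j.+1 - x j) ^+ k.+1)) ^+ 2) * (x j.+1 - x j).
Proof.
move=> sT bnd; have sT' : s \in `[0, T] by exact: subset_itv_oo_cc.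
have ab := x_incr jN.
have [yx xy] := cell_sub jN.
have c_er := poly_on_cell (er_poly sT'); have c_ew := poly_on_cell (ew_poly sT').
have c_dr := poly_on_cell (dt_rhoh_poly x_mesh h_sol jN sT).
have c_dw := poly_on_cell (dt_omegah_poly x_mesh h_sol jN sT).
have c_der := poly_on_cell (poly_on_time_derivative ab er_poly er_diff sT).
have c_dew := poly_on_cell (poly_on_time_derivative ab ew_poly ew_diff sT).
(* [approx_is_derive] describes [dqr] in time only. Its regularity in space is read off [der], the
   time derivative of a polynomial family. *)
have c_dqr : continuous_cell (x j) (x j.+1) (dqr s).
  have -> : dqr s = (fun y => der s y + derive_on 0 T (rhoh ^~ y) s).
    by apply/funext => y; rewrite /der subrK.
  exact: continuous_cellD.
have c_dqw : continuous_cell (x j) (x j.+1) (dqw s).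
  have -> : dqw s = (fun y => dew s y + derive_on 0 T (omegah ^~ y) s).
    by apply/funext => y; rewrite /dew subrK.
  exact: continuous_cellD.
have c_u := uh_cell sT' jN.
have c_r := rhoh_cell sT' jN; have c_w := omegah_cell sT' jN.
have c_uw : continuous_cell (x j) (x j.+1) (fun y => uh s y * omegah s y).
  exact: continuous_cellM.
have c_ru : continuous_cell (x j) (x j.+1) (fun y => rhoh s y * uh s y).
  exact: continuous_cellM.
(* Testing the scheme with the discrete error itself replaces the time derivative of [rhoh] by
   [- uh * omegah] under the integral. *)
have Er : \int[mu]_(y in `[x j, x j.+1]) (der s y * er s y) =
    \int[mu]_(y in `[x j, x j.+1]) ((dqr s y + uh s y * omegah s y) * er s y).
  under eq_Rintegral do rewrite mulrBl.
  under [RHS]eq_Rintegral do rewrite mulrDl.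
  rewrite RintegralB//; [|exact/continuous_cell_integrable/continuous_cellM..].
  rewrite RintegralD//; [|exact/continuous_cell_integrable/continuous_cellM..].
  by rewrite (scheme_rho_test h_sol sT' jN c_dr (er_poly sT')) opprK.
have Ew : \int[mu]_(y in `[x j, x j.+1]) (dew s y * ew s y) =
    \int[mu]_(y in `[x j, x j.+1]) ((dqw s y - rhoh s y * uh s y) * ew s y).
  under eq_Rintegral do rewrite mulrBl.
  under [RHS]eq_Rintegral do rewrite mulrBl.
  rewrite RintegralB//; [|exact/continuous_cell_integrable/continuous_cellM..].
  rewrite RintegralB//; [|exact/continuous_cell_integrable/continuous_cellM..].
  by rewrite (scheme_omega_test h_sol sT' jN c_dw (ew_poly sT')).
set c := 4 * _.
have c_Er : continuous_cell (x j) (x j.+1)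
    (fun y => (dqr s y + uh s y * omegah s y) * er s y).
  by apply: continuous_cellM => //; exact: continuous_cellD.
have c_Ew : continuous_cell (x j) (x j.+1)
    (fun y => (dqw s y - rhoh s y * uh s y) * ew s y).
  by apply: continuous_cellM => //; exact: continuous_cellB.
have c_D : continuous_cell (x j) (x j.+1)
    (fun y => (dqr s y + uh s y * omegah s y) * er s y
      + (dqw s y - rhoh s y * uh s y) * ew s y).
  exact: continuous_cellD.
have c_e2 : continuous_cell (x j) (x j.+1) (fun y => er s y ^+ 2 + ew s y ^+ 2).
  by apply: continuous_cellD; exact: continuous_cellX2.
have c_c := @continuous_cell_cst _ (x j) (x j.+1) c.
rewrite /error_energy_derivative /error_energy Er Ew -mulrDr.
rewrite -[X in 2 * X <= _]RintegralD//; [|exact: continuous_cell_integrable..].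
rewrite -RintegralD//; [|exact/continuous_cell_integrable/continuous_cellX2..].
rewrite -RintegralZl//; last exact: continuous_cell_integrable.
rewrite -(Rintegral_cst_itv c (ltW ab)).
rewrite -RintegralD//; [|exact: continuous_cell_integrable..].
apply: le_Rintegral_oo.
- by apply: continuous_cellM => //; exact: continuous_cell_cst.
- exact: continuous_cellD.
move=> y yab; have yab' : y \in `[x j, x j.+1] by exact: subset_itv_oo_cc.
have yI : y \in `]yL, yR[.
  move: yab; rewrite !in_itv/= => /andP[h1 h2].
  by rewrite (le_lt_trans yx)// (lt_le_trans h2).
have [uB wM rM uU] := bnd y (subset_itv_oo_cc yI).
apply: (@energy_density_le (u s y) (uh s y) (omega s y) (rho s y)) => //.
- exact: approx_le r_approx _ _ sT' yab'.
- exact: approx_le w_approx _ _ sT' yab'.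
- have := eq_rho u_sol sT' yI => /eqP; rewrite addr_eq0 => /eqP <-.
  exact: approx_derive_le r_approx _ _ sT yab'.
- have := eq_omega u_sol sT' yI => <-.
  exact: approx_derive_le w_approx _ _ sT yab'.
Qed.

End cell.


Let mesh_width : \sum_(j < N) (x j.+1 - x j) = yR - yL.
Proof.
by rewrite -(big_mkord xpredT (fun j => x j.+1 - x j)) telescope_sumr// x0 xN.
Qed.

Lemma mesh_size_ge0 : 0 <= mesh_size N x.
Proof. exact: bigmax_ge_id. Qed.

Lemma mesh_size_ge j : (j < N)%N -> x j.+1 - x j <= mesh_size N x.
Proof.
by move=> jN; exact: (le_bigmax _ (fun j : 'I_N => x j.+1 - x j) (Ordinal jN)).
Qed.

Lemma mesh_size_le : mesh_size N x <= yR - yL.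
Proof.
have x_le i j : (i <= j <= N)%N -> x i <= x j by exact: mesh_le.
apply: bigmax_le => [|j _]; first by rewrite -xN -x0 subr_ge0 x_le// leqnn.
by have [yx xy] := cell_sub (ltn_ord j); exact: lerB.
Qed.

(** * Summation over the cells and Gronwall's inequality *)

Section total.
Variables (C0 K M : R).
Hypothesis K0 : 0 <= K.
Hypothesis bounds : {in `[0, T] & `[yL, yR], forall s y,
  [/\ `|u s y| <= M, `|omega s y| <= M & `|rho s y| <= M]}.
Variables (qr dqr qw dqw : nat -> R -> R -> R).
Hypothesis r_approx : forall j, (j < N)%N ->
  polynomial_approximation T rho k (x j) (x j.+1) K (qr j) (dqr j).
Hypothesis w_approx : forall j, (j < N)%N ->
  polynomial_approximation T omega k (x j) (x j.+1) K (qw j) (dqw j).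

Let L := yR - yL.
Let H := mesh_size N x ^+ k.+1.

Hypothesis rho_init :
  \int[mu]_(y in `[yL, yR]) ((rho 0 y - rhoh 0 y) ^+ 2) <= (C0 * H) ^+ 2.
Hypothesis omega_init :
  \int[mu]_(y in `[yL, yR]) ((omega 0 y - omegah 0 y) ^+ 2) <= (C0 * H) ^+ 2.
Hypothesis T0 : 0 < T.

Let L0 : 0 <= L. Proof. exact: le_trans mesh_size_ge0 mesh_size_le. Qed.
Let H0 : 0 <= H. Proof. by rewrite exprn_ge0// mesh_size_ge0. Qed.
Let HL : H <= L ^+ k.+1.
Proof. by rewrite lerXn2r ?nnegrE ?mesh_size_ge0// mesh_size_le. Qed.

Let cell_le j : (j < N)%N -> K * (x j.+1 - x j) ^+ k.+1 <= K * H.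
Proof.
move=> jN; rewrite ler_wpM2l// lerXn2r ?nnegrE ?mesh_size_ge0 ?mesh_size_ge//.
by rewrite subr_ge0 ltW// x_incr.
Qed.

Let sum_sqr_dist_le (eta : R) f g h :
  (forall j, (j < N)%N -> continuous_cell (x j) (x j.+1) f) ->
  (forall j, (j < N)%N -> continuous_cell (x j) (x j.+1) g) ->
  (forall j, (j < N)%N -> continuous_cell (x j) (x j.+1) (h j)) ->
  (forall j, (j < N)%N -> {in `]x j, x j.+1[, forall y, `|f y - h j y| <= eta}) ->
  \sum_(j < N) \int[mu]_(y in `[x j, x j.+1]) ((f y - g y) ^+ 2)
  <= 2 * (\sum_(j < N) \int[mu]_(y in `[x j, x j.+1]) ((h j y - g y) ^+ 2))
     + 2 * eta ^+ 2 * L.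
Proof.
move=> cf cg ch fh; rewrite /L -mesh_width !mulr_sumr -big_split/=.
apply: ler_sum => j _; have jN := ltn_ord j.
apply: sqr_dist_Rintegral_le;
  [by rewrite ltW// x_incr|exact: cf|exact: cg|exact: ch|exact: fh].
Qed.

Let sum_sqr_dist_ge (eta : R) f g h :
  (forall j, (j < N)%N -> continuous_cell (x j) (x j.+1) f) ->
  (forall j, (j < N)%N -> continuous_cell (x j) (x j.+1) g) ->
  (forall j, (j < N)%N -> continuous_cell (x j) (x j.+1) (h j)) ->
  (forall j, (j < N)%N -> {in `]x j, x j.+1[, forall y, `|f y - h j y| <= eta}) ->
  \sum_(j < N) \int[mu]_(y in `[x j, x j.+1]) ((h j y - g y) ^+ 2)
  <= 2 * (\sum_(j < N) \int[mu]_(y in `[x j, x j.+1]) ((f y - g y) ^+ 2))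
     + 2 * eta ^+ 2 * L.
Proof.
move=> cf cg ch fh; rewrite /L -mesh_width !mulr_sumr -big_split/=.
apply: ler_sum => j _; have jN := ltn_ord j.
apply: sqr_dist_Rintegral_le; [rewrite ltW// x_incr//|exact: ch|exact: cg|exact: cf|].
by move=> y yab; rewrite distrC; exact: fh.
Qed.

Let rho_cell (s : R) : s \in `[0, T] -> forall j, (j < N)%N ->
  continuous_cell (x j) (x j.+1) (rho s).
Proof. by move=> sT j; exact: smooth_cell (smooth_rho u_sol) sT. Qed.

Let omega_cell (s : R) : s \in `[0, T] -> forall j, (j < N)%N ->
  continuous_cell (x j) (x j.+1) (omega s).
Proof. by move=> sT j; exact: smooth_cell (smooth_omega u_sol) sT. Qed.

Let qr_cell (s : R) j : (j < N)%N -> continuous_cell (x j) (x j.+1) (qr j s).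
Proof. by move=> jN; apply: poly_on_cell; exact: approx_poly (r_approx jN) s. Qed.

Let qw_cell (s : R) j : (j < N)%N -> continuous_cell (x j) (x j.+1) (qw j s).
Proof. by move=> jN; apply: poly_on_cell; exact: approx_poly (w_approx jN) s. Qed.

Let qr_le (s : R) : s \in `[0, T] -> forall j, (j < N)%N ->
  {in `]x j, x j.+1[, forall y, `|rho s y - qr j s y| <= K * H}.
Proof.
move=> sT j jN y yab; apply: le_trans (cell_le jN).
by apply: approx_le (r_approx jN) _ _ sT _; exact: subset_itv_oo_cc.
Qed.

Let qw_le (s : R) : s \in `[0, T] -> forall j, (j < N)%N ->
  {in `]x j, x j.+1[, forall y, `|omega s y - qw j s y| <= K * H}.
Proof.
move=> sT j jN y yab; apply: le_trans (cell_le jN).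
by apply: approx_le (w_approx jN) _ _ sT _; exact: subset_itv_oo_cc.
Qed.

Let E (s : R) := \sum_(j < N) error_energy j (qr j) (qw j) s.
Let dE (s : R) :=
  \sum_(j < N) error_energy_derivative j (qr j) (dqr j) (qw j) (dqw j) s.

Let E_split (s : R) : E s
  = \sum_(j < N) \int[mu]_(y in `[x j, x j.+1]) ((qr j s y - rhoh s y) ^+ 2)
  + \sum_(j < N) \int[mu]_(y in `[x j, x j.+1]) ((qw j s y - omegah s y) ^+ 2).
Proof. by rewrite -big_split. Qed.

Let sqr_int_ge0 f (j : nat) : 0 <= \int[mu]_(y in `[x j, x j.+1]) (f y ^+ 2).
Proof. by apply: Rintegral_ge0 => y _; exact: sqr_ge0. Qed.

Let E_ge0 (s : R) : 0 <= E s.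
Proof. by rewrite E_split addr_ge0// sumr_ge0. Qed.

Let rho_error_le (s : R) : s \in `[0, T] ->
  \int[mu]_(y in `[yL, yR]) ((rho s y - rhoh s y) ^+ 2)
  <= 2 * E s + 2 * (K * H) ^+ 2 * L.
Proof.
move=> sT; rewrite mesh_sum => [|j jN]; last exact/continuous_cellX2/rho_error_cell.
apply: le_trans (sum_sqr_dist_le (rho_cell sT) (fun j => @rhoh_cell s j sT)
  (@qr_cell s) (qr_le sT)) _.
by rewrite lerD2r ler_wpM2l// E_split lerDl sumr_ge0.
Qed.

Lemma omega_error_le (s : R) : s \in `[0, T] ->
  \int[mu]_(y in `[yL, yR]) ((omega s y - omegah s y) ^+ 2)
  <= 2 * E s + 2 * (K * H) ^+ 2 * L.
Proof.
move=> sT; rewrite mesh_sum => [|j jN]; last exact/continuous_cellX2/omega_error_cell.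
apply: le_trans (sum_sqr_dist_le (omega_cell sT) (fun j => @omegah_cell s j sT)
  (@qw_cell s) (qw_le sT)) _.
by rewrite lerD2r ler_wpM2l// E_split lerDr sumr_ge0.
Qed.

Let T00 : 0 \in `[0, T]. Proof. by rewrite in_itv/= lexx ltW. Qed.

Let E_init : E 0 <= 4 * (C0 * H) ^+ 2 + 4 * (K * H) ^+ 2 * L.
Proof.
have h1 := sum_sqr_dist_ge (rho_cell T00) (fun j => @rhoh_cell 0 j T00)
  (@qr_cell 0) (qr_le T00).
have h2 := sum_sqr_dist_ge (omega_cell T00) (fun j => @omegah_cell 0 j T00)
  (@qw_cell 0) (qw_le T00).
have h3 := rho_init; have h4 := omega_init.
rewrite mesh_sum in h3; last by move=> j jN; exact/continuous_cellX2/rho_error_cell.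
rewrite mesh_sum in h4; last by move=> j jN; exact/continuous_cellX2/omega_error_cell.
by rewrite E_split; lra.
Qed.

(** [M] bounds the boundary value at [yR], and [1 + X] is a substitute for the square root of [X],
    where [X] bounds the squared deviation of [uh] from it. The conserved energy in [X] is estimated
    from the exact initial data and the initial error, with [L ^+ k.+1] in place of [H] to be
    independent of the mesh. *)
Definition uh_bound :=
  M + (1 + L * (4 * M ^+ 2 * L + 4 * (C0 * L ^+ k.+1) ^+ 2)).

Lemma uh_le : {in `[0, T] & `[yL, yR], forall s y, `|uh s y| <= uh_bound}.
Proof.
move=> s y sT yI; have := uh_sqr_le sT yI.
have yRI : yR \in `[yL, yR] by rewrite in_itv/= lexx andbT -subr_ge0.
have [uM _ _] := bounds sT yRI.
set I1 := \int[mu]_(z in _) _; set I2 := \int[mu]_(z in _) _ => uh2.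
have C0H : (C0 * H) ^+ 2 <= (C0 * L ^+ k.+1) ^+ 2.
  by rewrite !exprMn ler_wpM2l ?sqr_ge0// lerXn2r// nnegrE exprn_ge0.
have zero_cell j : (j < N)%N -> continuous_cell (x j) (x j.+1) (fun=> 0 : R).
  by move=> _; exact: continuous_cell_cst.
have sqr_init_le f fh : {in `[yL, yR], forall z, `|f z| <= M} ->
    (forall j, (j < N)%N -> continuous_cell (x j) (x j.+1) f) ->
    (forall j, (j < N)%N -> continuous_cell (x j) (x j.+1) fh) ->
    \int[mu]_(z in `[yL, yR]) ((f z - fh z) ^+ 2) <= (C0 * H) ^+ 2 ->
    \int[mu]_(z in `[yL, yR]) (fh z ^+ 2)
      <= 2 * (C0 * L ^+ k.+1) ^+ 2 + 2 * M ^+ 2 * L.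
  move=> fM cf cfh f_init.
  (* Taking 0 for the first function, [f] as its approximation and [M] as the distance bounds the
     norm of [fh] by the initial error and the size of [f]. *)
  have /(_ M) := sum_sqr_dist_le zero_cell cfh (h := fun=> f) cf.
  rewrite -mesh_sum => [|j jN]; last first.
    apply: continuous_cellX2.
    by apply: continuous_cellB; [exact: zero_cell|exact: cfh].
  rewrite -mesh_sum => [|j jN]; last first.
    by apply: continuous_cellX2; apply: continuous_cellB; [exact: cf|exact: cfh].
  under eq_Rintegral do rewrite sub0r sqrrN.
  move=> h; apply: le_trans (h _) _ => [j jN z zab|].
    rewrite sub0r normrN; apply: fM.
    have [yx xy] := cell_sub jN; move: zab; rewrite !in_itv/= => /andP[h1 h2].
    by rewrite (le_trans yx (ltW h1)) (le_trans (ltW h2)).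
  by rewrite lerD2r ler_wpM2l// (le_trans f_init).
have I1_le : I1 <= 2 * (C0 * L ^+ k.+1) ^+ 2 + 2 * M ^+ 2 * L.
  apply: (sqr_init_le (rho 0)) => //.
  - by move=> z zI; have [] := bounds T00 zI.
  - exact: rho_cell.
  - by move=> j; exact: rhoh_cell.
have I2_le : I2 <= 2 * (C0 * L ^+ k.+1) ^+ 2 + 2 * M ^+ 2 * L.
  apply: (sqr_init_le (omega 0)) => //.
  - by move=> z zI; have [] := bounds T00 zI.
  - exact: omega_cell.
  - by move=> j; exact: omegah_cell.
rewrite -(subrK (u s yR) (uh s y)) addrC (le_trans (ler_normD _ _))// lerD//.
set d := uh s y - u s yR in uh2 *.
have : `|d| ^+ 2 <= L * (4 * M ^+ 2 * L + 4 * (C0 * L ^+ k.+1) ^+ 2).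
  rewrite real_normK ?num_real// (le_trans uh2)// ler_wpM2l//; lra.
(* Nonnegativity of [|d|] and of the square of [|d| - 1] gives [|d| <= 1 + |d| ^+ 2]. *)
have := sqr_ge0 (`|d| - 1); have := normr_ge0 d; lra.
Qed.

(** Summing the cell inequalities and inserting the bound of the squared error of [u] by
    [L * (2 * E s + 2 * (K * H) ^+ 2 * L)], [growth] collects the coefficient of [E s] and [source]
    that of [H ^+ 2]. The first three terms of [energy_constant] are then those of [E 0] and of the
    source. *)
Definition growth := 1 + 8 * L ^+ 2 * M ^+ 2.
Definition source := 4 * L * (2 * M ^+ 2 * L ^+ 2 + (1 + uh_bound) ^+ 2) * K ^+ 2.
Definition energy_constant :=
  (4 * C0 ^+ 2 + 4 * K ^+ 2 * L + source) * expR (growth * T).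

Let dE_le (s : R) : s \in `]0, T[ -> dE s <= growth * E s + source * H ^+ 2.
Proof.
move=> sT; have sT' : s \in `[0, T] by exact: subset_itv_oo_cc.
(* This closes the estimate: the error of [u] is controlled by that of [omega] over the whole
   interval, hence by the total energy and the Taylor remainder. *)
pose U := L * (2 * E s + 2 * (K * H) ^+ 2 * L).
have bnd : {in `[yL, yR], forall y, [/\ `|uh s y| <= uh_bound, `|omega s y| <= M,
    `|rho s y| <= M & (u s y - uh s y) ^+ 2 <= U]}.
  move=> y yI; have [_ wM rM] := bounds sT' yI; split => //; first exact: uh_le.
  by apply: le_trans (u_error_sqr_le sT' yI) _; rewrite ler_wpM2l// omega_error_le.
have B0 : 0 <= uh_bound.
  have yRI : yR \in `[yL, yR] by rewrite in_itv/= lexx andbT -subr_ge0.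
  by apply: le_trans (uh_le sT' yRI).
have -> : growth * E s + source * H ^+ 2
    = E s + 4 * (M ^+ 2 * U + ((1 + uh_bound) * (K * H)) ^+ 2) * L.
  by rewrite /growth /source /U; ring.
rewrite /L -mesh_width /E /dE mulr_sumr -big_split/=.
apply: ler_sum => j _; have jN := ltn_ord j.
apply: le_trans (error_energy_derivative_le jN (r_approx jN) (w_approx jN) sT bnd) _.
rewrite lerD2l ler_wpM2r ?subr_ge0 ?(ltW (x_incr jN))//.
have KD0 : 0 <= K * (x j.+1 - x j) ^+ k.+1.
  by rewrite mulr_ge0// exprn_ge0// subr_ge0 ltW// x_incr.
have B1 : 0 <= 1 + uh_bound by rewrite addr_ge0.
rewrite ler_wpM2l// lerD2l lerXn2r ?nnegrE//.
- exact: mulr_ge0.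
- exact/mulr_ge0/mulr_ge0.
- by rewrite ler_wpM2l// cell_le.
Qed.

Lemma total_energy_le (s : R) : s \in `[0, T] -> E s <= energy_constant * H ^+ 2.
Proof.
move=> sT.
have cE : {within `[0, T], continuous E}.
  apply: within_continuous_sum => j.
  exact: error_energy_continuous (r_approx _) (w_approx _).
have dEE (r : R) : r \in `]0, T[ -> is_derive r (1 : R) E (dE r).
  move=> rT.
  have -> : E = \sum_(j < N) error_energy j (qr j) (qw j).
    by apply/funext => r'; rewrite fct_sumE.
  apply: is_derive_sum => j.
  have jN := ltn_ord j.
  exact: (error_energy_is_derive jN (r_approx jN) (w_approx jN) rT).
have source0 : 0 <= source.
  rewrite /source mulr_ge0 ?sqr_ge0// mulr_ge0//; first exact: mulr_ge0.
  by rewrite addr_ge0 ?sqr_ge0// mulr_ge0 ?sqr_ge0// mulr_ge0 ?sqr_ge0.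
have growth1 : 1 <= growth.
  by rewrite /growth lerDl mulr_ge0 ?sqr_ge0// mulr_ge0 ?sqr_ge0.
have D0 : 0 <= source * H ^+ 2 by rewrite mulr_ge0 ?sqr_ge0.
have Es := gronwall T0 D0 growth1 cE dEE dE_le (E_ge0 0) sT.
apply: (@le_trans _ _ (E s + source * H ^+ 2)); first by rewrite lerDl.
apply: le_trans Es _.
rewrite /energy_constant [leRHS]mulrAC ler_wpM2r ?expR_ge0//.
by have := E_init; lra.
Qed.

Definition error_constant := 2 * energy_constant + 2 * K ^+ 2 * L.

Lemma rho_omega_error_le (s : R) : s \in `[0, T] ->
  \int[mu]_(y in `[yL, yR]) ((rho s y - rhoh s y) ^+ 2)
    <= error_constant * H ^+ 2 /\
  \int[mu]_(y in `[yL, yR]) ((omega s y - omegah s y) ^+ 2)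
    <= error_constant * H ^+ 2.
Proof.
move=> sT; have h := total_energy_le sT.
have -> : error_constant * H ^+ 2
    = 2 * (energy_constant * H ^+ 2) + 2 * (K * H) ^+ 2 * L.
  by rewrite /error_constant; ring.
split; [apply: le_trans (rho_error_le sT) _|apply: le_trans (omega_error_le sT) _].
  by rewrite lerD2r ler_wpM2l.
by rewrite lerD2r ler_wpM2l.
Qed.

End total.

End error_estimate.

(** Lets [rho] and [omega] share one constant. *)
Lemma polynomial_approximation_le (R : realType) (T : R) (f : R -> R -> R) (k : nat)
    (a b K K' : R) (q dq : R -> R -> R) : a < b -> K <= K' ->
  polynomial_approximation T f k a b K q dq ->
  polynomial_approximation T f k a b K' q dq.
Proof.
move=> ab KK' [qp qc qd qf dqf]; split => // s y sT yab.
  by apply: le_trans (qf s y sT yab) _; rewrite ler_wpM2r// exprn_ge0// subr_ge0 ltW.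
by apply: le_trans (dqf s y sT yab) _; rewrite ler_wpM2r// exprn_ge0// subr_ge0 ltW.
Qed.


Import numFieldNormedType.Exports.

Local Open Scope classical_set_scope.
Local Open Scope ring_scope.

Theorem theorem2p7 (R : realType) (k : nat) (T yL yR : R)
    (hT : 0 < T) (hI : yL < yR)
    (gL gR : R -> R) (u rho omega : R -> R -> R)
    (hsol : smooth_solution T yL yR gL gR u rho omega)
    (C0 sigma : R) :
  exists C : R, 0 < C /\
    forall (N : nat) (x : nat -> R) (uh rhoh omegah : R -> R -> R),
      is_mesh yL yR N x ->
      regular_mesh sigma N x ->
      idg_solution k T yL yR u N x uh rhoh omegah ->
      (norm_Loo yL yR (u 0 \- uh 0)%R
       + norm_L2 yL yR (rho 0 \- rhoh 0)%R
       + norm_L2 yL yR (omega 0 \- omegah 0)%R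
       <= (C0 * mesh_size N x ^+ k.+1)%:E)%E ->
      forall s : R, s \in `[0, T] ->
        (norm_Loo yL yR (u s \- uh s)%R
         + norm_L2 yL yR (omega s \- omegah s)%R
         + norm_L2 yL yR (rho s \- rhoh s)%R
         <= (C * mesh_size N x ^+ k.+1)%:E)%E.
Proof.
have [Mu uM] := smooth_bounded (smooth_u hsol).
have [Mw wM] := smooth_bounded (smooth_omega hsol).
have [Mr rM] := smooth_bounded (smooth_rho hsol).
have [Kr Kr0 rK] := smooth_approximation (smooth_rho hsol) k.
have [Kw Kw0 wK] := smooth_approximation (smooth_omega hsol) k.
pose M := `|Mu| + `|Mw| + `|Mr|; pose K := Kr + Kw.
have K0 : 0 <= K by exact: addr_ge0.
have bounds : {in `[0, T] & `[yL, yR], forall s y,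
    [/\ `|u s y| <= M, `|omega s y| <= M & `|rho s y| <= M]}.
  move=> s y sT yI; rewrite /M.
  have := (uM s y sT yI, wM s y sT yI, rM s y sT yI) => -[[hu hw] hr].
  have := (ler_norm Mu, ler_norm Mw, ler_norm Mr) => -[[nu nw] nr].
  have := (normr_ge0 Mu, normr_ge0 Mw, normr_ge0 Mr) => -[[pu pw] pr].
  by split; lra.
pose C2 := error_constant k T yL yR C0 K M.
pose L := yR - yL; have L0 : 0 <= L by rewrite subr_ge0 ltW.
(* [c] and [d] dominate the square roots of [C2] and of [L * |C2|], since [z <= (1 + z) ^+ 2] for
   [z >= 0]. They serve the two L2 norms and the sup norm respectively. *)
pose c := 1 + `|C2|; have c0 : 0 <= c by rewrite addr_ge0.
pose d := 1 + L * `|C2|; have d0 : 0 < d by rewrite ltr_wpDr// mulr_ge0.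
exists (d + c + c); split; first by rewrite -addrA ltr_wpDr// addr_ge0.
move=> N x uh rhoh omegah x_mesh _ h_sol init s sT.
have T00 : 0 \in `[0, T] by rewrite in_itv/= lexx ltW.
pose H := mesh_size N x ^+ k.+1.
have H0 : 0 <= H by rewrite exprn_ge0// mesh_size_ge0.
have [x0 xN x_incr] : [/\ x 0%N = yL, x N = yR & forall j, (j < N)%N -> x j < x j.+1].
  by case: x_mesh.
have cell j : (j < N)%N -> [/\ yL <= x j, x j < x j.+1 & x j.+1 <= yR].
  move=> jN; split; [|exact: x_incr|].
    by rewrite -x0; apply: (mesh_le x_incr); rewrite leq0n ltnW.
  by rewrite -xN; apply: (mesh_le x_incr); rewrite jN leqnn.
have [|qr qrP] := @choice nat ((R -> R -> R) * (R -> R -> R)) (fun j q => (j < N)%N ->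
    polynomial_approximation T rho k (x j) (x j.+1) K q.1 q.2).
  (* Approximants are chosen cell by cell; past the last cell the pair is an arbitrary default. *)
  move=> j; have [jN|jN] := ltnP j N; last by exists (rho, rho).
  have [yx xx xy] := cell j jN; have [q [dq qP]] := rK _ _ yx xx xy.
  by exists (q, dq) => _; apply: polynomial_approximation_le qP => //; rewrite lerDl.
have [|qw qwP] := @choice nat ((R -> R -> R) * (R -> R -> R)) (fun j q => (j < N)%N ->
    polynomial_approximation T omega k (x j) (x j.+1) K q.1 q.2).
  move=> j; have [jN|jN] := ltnP j N; last by exists (rho, rho).
  have [yx xx xy] := cell j jN; have [q [dq qP]] := wK _ _ yx xx xy.
  by exists (q, dq) => _; apply: polynomial_approximation_le qP => //; rewrite lerDr.
have ir s' := rho_error_integrable hsol x_mesh h_sol (s := s').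
have iw s' := omega_error_integrable hsol x_mesh h_sol (s := s').
have n_ge0 p f : (0 <= Lp_norm_on p yL yR f)%E by exact: Lnorm_ge0.
have rho_init := norm_L2_ge (ir 0 T00) (le_trans
  (le_trans (leeDr _ (n_ge0 _ _)) (leeDl _ (n_ge0 _ _))) init).
have omega_init := norm_L2_ge (iw 0 T00) (le_trans
  (leeDr _ (adde_ge0 (n_ge0 _ _) (n_ge0 _ _))) init).
have [rho_le omega_le] := rho_omega_error_le hsol x_mesh h_sol K0 bounds
  qrP qwP rho_init omega_init hT sT.
rewrite -/C2 -/H in rho_le omega_le.
have C2c : C2 * H ^+ 2 <= (c * H) ^+ 2.
  rewrite exprMn ler_wpM2r ?sqr_ge0// /c.
  by have := ler_norm C2; have := normr_ge0 C2; have := sqr_ge0 `|C2|; lra.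
rewrite -/H (mulrDl (d + c)) (mulrDl d) 2!EFinD; apply: leeD; [apply: leeD|].
- apply: norm_Loo_le => [|y yI]; first by rewrite mulr_ge0// ltW.
  have yI' : y \in `[yL, yR] by exact: subset_itv_oo_cc.
  have u_le := u_error_sqr_le hsol x_mesh h_sol sT yI'.
  have dH0 : 0 <= d * H by rewrite mulr_ge0// ltW.
  rewrite -(@ler_pXn2r _ 2)// ?nnegrE// real_normK ?num_real//.
  apply: le_trans u_le _; rewrite -/L.
  apply: (@le_trans _ _ (L * (`|C2| * H ^+ 2))).
    by rewrite ler_wpM2l// (le_trans omega_le)// ler_wpM2r ?sqr_ge0// ler_norm.
  rewrite mulrA exprMn ler_wpM2r ?sqr_ge0// /d.
  have : 0 <= L * `|C2| by rewrite mulr_ge0.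
  by move: (L * _) => z z0; have := sqr_ge0 z; lra.
- by apply: norm_L2_le; [exact: iw|exact: mulr_ge0|exact: le_trans omega_le _].
- by apply: norm_L2_le; [exact: ir|exact: mulr_ge0|exact: le_trans rho_le _].
Qed.
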